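(* Let $(A,\mathfrak{m})$ be a Cohen-Macaulay local ring of dimension $d\ge 2$ with infinite residue field, let $I$ be an $\mathfrak{m}$-primary ideal of $A$, and let $Q$ be a parameter ideal of $A$ which is a reduction of $I$. If $I^3=QI^2$ and $\mathfrak{m}I^2\subseteq QI$, then $$\mathrm{e}_1(I)\ \ge\ \mathrm{e}_0(I)-\ell_A(A/I)+\mathrm{e}_2(I).$$
   Context: $\ell_A(-)$ denotes length of $A$-modules. The Hilbert coefficients $\mathrm{e}_0(I),\dots,\mathrm{e}_d(I)$ are the integers such that for all $n\gg 0$, $$\ell_A(A/I^{n+1})=\mathrm{e}_0(I)\binom{n+d}{d}-\mathrm{e}_1(I)\binom{n+d-1}{d-1}+\cdots+(-1)^d\mathrm{e}_d(I).$$ *)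

(* Defs.v *)
From HB Require Import structures.
From mathcomp Require Import all_boot all_order all_algebra.
From mathcomp Require Import boolp classical_sets functions cardinality.

Set Implicit Arguments.
Unset Strict Implicit.
Unset Printing Implicit Defensive.

Import Order.TTheory GRing.Theory Num.Theory.

Local Open Scope classical_set_scope.
Local Open Scope ring_scope.

(* A chain of length n is c 0 `<` c 1 `<` ... `<` c n: n counts the strict
   inclusions, and the values of c beyond n are irrelevant. *)
Definition strict_chain (T : Type) (P : set T -> Prop) (n : nat)
    (c : nat -> set T) : Prop :=
  (forall i, (i <= n)%N -> P (c i)) /\
  (forall i, (i < n)%N -> c i `<` c i.+1).

Definition max_chain_length (T : Type) (P : set T -> Prop) (n : nat) : Prop :=
  (exists c, strict_chain P n c) /\
  (forall k c, strict_chain P k c -> (k <= n)%N).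

Definition submodule (A : comNzRingType) (V : lmodType A) (N : set V) : Prop :=
  [/\ N 0, (forall x y, N x -> N y -> N (x + y)) &
      (forall (a : A) x, N x -> N (a *: x))].

(* has_length N' N n: the A-module N / N' has finite length n. The submodules
   of N / N' are the L / N' for L a submodule of V with N' `<=` L `<=` N. *)
Definition has_length (A : comNzRingType) (V : lmodType A) (N' N : set V)
    (n : nat) : Prop :=
  max_chain_length (fun L : set V => [/\ submodule L, N' `<=` L & L `<=` N]) n.

Section Ideals.
Variable A : comNzRingType.
Implicit Types (I J Q P m : set A) (s : seq A).

Definition ideal I : Prop := submodule (I : set A^o).

(* The length of the A-module A / I. *)
Definition has_colength I (n : nat) : Prop :=
  has_length (I : set A^o) setT n.

Definition ideal_gen s : set A :=
  [set y | exists c : 'I_(size s) -> A, y = \sum_(i < size s) c i * s`_i].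

Definition ideal_mul I J : set A :=
  [set y | exists n (a b : 'I_n -> A),
     [/\ (forall i, I (a i)), (forall i, J (b i)) &
         y = \sum_(i < n) a i * b i]].

Fixpoint ideal_exp I (n : nat) : set A :=
  if n is n'.+1 then ideal_mul I (ideal_exp I n') else setT.

Definition radical I : set A := [set x | exists n, I (x ^+ n)].

Definition prime_ideal P : Prop :=
  [/\ ideal P, ~ P 1 & forall x y, P (x * y) -> P x \/ P y].

Definition primary_ideal I : Prop :=
  [/\ ideal I, ~ I 1 & forall x y, I (x * y) -> I x \/ radical I y].

Definition maximal_ideal m : Prop :=
  [/\ ideal m, ~ m 1 &
      forall J, ideal J -> m `<=` J -> ~ J 1 -> J = m].

Definition noetherian : Prop :=
  forall I, ideal I -> exists s, I = ideal_gen s.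

Definition noetherian_local m : Prop :=
  [/\ noetherian, maximal_ideal m & forall m', maximal_ideal m' -> m' = m].

Definition krull_dim (n : nat) : Prop := max_chain_length prime_ideal n.

Definition regular_sequence s : Prop :=
  (forall i, (i < size s)%N -> forall a : A,
     ideal_gen (take i s) (s`_i * a) -> ideal_gen (take i s) a) /\
  ~ ideal_gen s 1.

Definition depth m (n : nat) : Prop :=
  (exists s, [/\ regular_sequence s, (forall x, x \in s -> m x) &
                 size s = n]) /\
  (forall s, regular_sequence s -> (forall x, x \in s -> m x) ->
     (size s <= n)%N).

Definition cohen_macaulay_local m : Prop :=
  noetherian_local m /\ exists n, krull_dim n /\ depth m n.

(* The set of cosets x + m, for x in A. *)
Definition residue_field m : set (set A) :=
  range (fun x : A => [set y | m (y - x)]).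

Definition primary_to m I : Prop := primary_ideal I /\ radical I = m.

(* An ideal generated by a system of parameters of a local ring of
   dimension d. *)
Definition parameter_ideal m (d : nat) Q : Prop :=
  primary_to m Q /\ exists s, size s = d /\ Q = ideal_gen s.

Definition reduction Q I : Prop :=
  Q `<=` I /\ exists n, ideal_exp I n.+1 = ideal_mul Q (ideal_exp I n).

(* e i is the Hilbert coefficient e_i(I) for i <= d; the values of e beyond d
   are not constrained. *)
Definition hilbert_coefficients (d : nat) I (e : nat -> int) : Prop :=
  exists N : nat, forall n : nat, (N <= n)%N ->
    exists l : nat, has_colength (ideal_exp I n.+1) l /\
      l%:Z = \sum_(i < d.+1) (-1) ^+ i * e i * ('C(n + d - i, d - i))%:Z.

End Ideals.

Arguments noetherian A : clear implicits.
Arguments krull_dim A n : clear implicits.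

(* Main.v *)
Require Import Defs.
From HB Require Import structures.
From mathcomp Require Import all_boot all_order all_algebra.
From mathcomp Require Import boolp classical_sets functions cardinality.
From mathcomp Require Import zify ring.

(* Idea. Since A is Cohen-Macaulay with infinite residue field, Q is generated
   by a regular sequence u_1..u_d, so l(Q^n/Q^n J) is l(A/J) times the number of
   monomials of degree n for every ideal J containing Q. Hence
     l(A/I^{n+2}) = l(A/Q) C(n+d,d) + l(A/I) C(n+d,d-1) - H(n),
   where H(n) = l(I^{n+2}/Q^{n+1}I) is, as I^{n+2} = Q^n I^2, the Hilbert function
   of the Sally module. By m I^2 <= QI this is a graded module over the polynomial
   ring (A/m)[X_1..X_d], generated in a single degree. Filtering by its generators,
   each cyclic subquotient is either free or has a Hilbert function that is
   O(n^{d-2}); so H(n) = r C(n+d-1,d-1) + h(n) with 0 <= h(n) = O(n^{d-2}).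
   Comparing with the Hilbert polynomial gives e_0 = l(A/Q),
   e_1 = e_0 - l(A/I) + r, and r >= e_2 because h is nonnegative. *)

Set Implicit Arguments.
Unset Strict Implicit.
Unset Printing Implicit Defensive.

Import Order.TTheory GRing.Theory Num.Theory.

Local Open Scope classical_set_scope.
Local Open Scope ring_scope.

(** The regular sequence is not the given generating system of [Q]. The depth supplies one of length
    d in m, which is exchanged into [Q] element by element: a generic combination of generators of
    [Q] replaces its last term and is then moved to the front. Genericity is where the infinite
    residue field enters: finitely many annihilators detect all zero divisors, and a Vandermonde
    determinant defeats each of them. Modules are represented by pairs of ideals of A, with lengths
    read off chains. A cyclic graded module generated by w becomes a sequence of ideals D_n of
    relations together with the ideals D_n + w Q^n, so neither quotients nor direct sums are formed.
    The sign needed for e_2 requires a lower bound r C(n+d-1,d-1) for H(n) without any error term.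
    It is available because all generators lie in degree 0: a free layer contributes exactly
    C(n+d-1,d-1), not a shifted count, and every other layer contributes at least 0. *)

Lemma max_chain_length_uniq (T : Type) (P : set T -> Prop) n n' :
  max_chain_length P n -> max_chain_length P n' -> n = n'.
Proof.
move=> [[c Hc] Hn] [[c' Hc'] Hn']; apply/eqP.
by rewrite eqn_leq (Hn' _ _ Hc) (Hn _ _ Hc').
Qed.

(** Repetitions are dropped, and the sum counts the strict steps that survive. The endpoint is
    recorded so that the induction can append the next term. *)
Lemma weak_chain (T : Type) (P : set T -> Prop) (f : nat -> set T) k :
    (forall i, (i <= k)%N -> P (f i)) ->
    (forall i, (i < k)%N -> f i `<=` f i.+1) ->
  exists2 c, strict_chain P (\sum_(i < k) `[< f i <> f i.+1 >])%N c
           & c (\sum_(i < k) `[< f i <> f i.+1 >])%N = f k.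
Proof.
elim: k => [|k IHk] Pf lef.
  by exists f; rewrite big_ord0.
have [||c [Pc ltc] ck] := IHk.
- by move=> i ik; apply: Pf; lia.
- by move=> i ik; apply: lef; lia.
rewrite big_ord_recr /=; set j := (\sum_(i < k) _)%N in Pc ltc ck *.
case: asboolP => [neq|/contrapT eqf]; last first.
  by exists c; rewrite addn0 // ck.
rewrite addn1.
exists (fun i => if (i <= j)%N then c i else f k.+1); last by rewrite ltnn.
split=> i ij.
  by case: ifP => [|_]; [exact: Pc | exact: Pf].
rewrite -ltnS ij; case: ifP => ij'; first by apply: ltc.
have -> : i = j by lia.
rewrite ck; split; first exact: lef.
by move=> le'; apply: neq; apply/seteqP; split => //; exact: lef.
Qed.

Lemma max_chain_length_iso (T : Type) (P P' : set T -> Prop)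
    (f g : set T -> set T) n :
    (forall L, P L -> P' (f L)) -> (forall L, P' L -> P (g L)) ->
    (forall L, P L -> g (f L) = L) -> (forall L, P' L -> f (g L) = L) ->
    {homo f : L M / L `<=` M} -> {homo g : L M / L `<=` M} ->
  max_chain_length P n -> max_chain_length P' n.
Proof.
have chainW Q Q' (h h' : set T -> set T) k c :
    (forall L, Q L -> Q' (h L)) -> (forall L, Q L -> h' (h L) = L) ->
    {homo h : L M / L `<=` M} ->  {homo h' : L M / L `<=` M} ->
    strict_chain Q k c -> strict_chain Q' k (h \o c).
  move=> Qh hK leh leh' [Qc ltc]; split=> i ik; first exact/Qh/Qc.
  have [le1 nle] := ltc _ ik; split=> /=; first exact: leh.
  by move=> /leh'; rewrite !hK //; apply: Qc; lia.
move=> Pf P'g fK gK lef leg [[c Hc] Hn]; split.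
  by exists (f \o c); apply: (chainW P P' f g).
by move=> k c' Hc'; apply: (Hn _ (g \o c')); apply: (chainW P' P g f).
Qed.

(** * Colon ideals and ideals of the form [K + s N] *)

Section IdealTheory.
Variable A : comNzRingType.
Implicit Types (I J K L M N P Q : set A) (a b s t w x y z : A).

Lemma ideal0 I : ideal I -> I 0. Proof. by case. Qed.
Lemma idealD I x y : ideal I -> I x -> I y -> I (x + y).
Proof. by case=> _ + _; apply. Qed.
Lemma idealMl I a x : ideal I -> I x -> I (a * x).
Proof. by case=> _ _; apply. Qed.
Lemma idealMr I a x : ideal I -> I x -> I (x * a).
Proof. by rewrite mulrC; exact: idealMl. Qed.
Lemma idealN I x : ideal I -> I x -> I (- x).
Proof. by rewrite -mulN1r; exact: idealMl. Qed.
Lemma idealB I x y : ideal I -> I x -> I y -> I (x - y).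
Proof. by move=> iI Ix Iy; apply: idealD => //; apply: idealN. Qed.
Lemma ideal_sum I (T : Type) (r : seq T) (p : pred T) (F : T -> A) :
  ideal I -> (forall i, p i -> I (F i)) -> I (\sum_(i <- r | p i) F i).
Proof.
by move=> iI IF; apply: big_ind => //; [exact: ideal0 | move=> *; exact: idealD].
Qed.

Lemma ideal_setT : ideal (setT : set A). Proof. by []. Qed.
Lemma mk_ideal I : I 0 -> (forall x y, I x -> I y -> I (x + y)) ->
  (forall a x, I x -> I (a * x)) -> ideal I.
Proof. by []. Qed.
Lemma ideal_set0 : ideal ([set 0] : set A).
Proof.
apply: mk_ideal => //= [x y -> ->|a x ->]; first exact: addr0.
exact: mulr0.
Qed.
Lemma ideal_setI I J : ideal I -> ideal J -> ideal (I `&` J).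
Proof.
move=> iI iJ; apply: mk_ideal => [|x y [Ix Jx] [Iy Jy]|a x [Ix Jx]].
- by split; exact: ideal0.
- by split; exact: idealD.
- by split; exact: idealMl.
Qed.

Definition colon K s N : set A := [set y | N y /\ K (s * y)].

Lemma ideal_colon K s N : ideal K -> ideal N -> ideal (colon K s N).
Proof.
move=> iK iN; apply: mk_ideal => [|x y [Nx Kx] [Ny Ky]|a x [Nx Kx]].
- by split; [exact: ideal0 | rewrite mulr0; exact: ideal0].
- by split; [exact: idealD | rewrite mulrDr; exact: idealD].
- by split; [exact: idealMl | rewrite mulrCA; exact: idealMl].
Qed.

(* [mix K s N] is the ideal [K + s N]. *)
Definition mix K s N : set A := [set z | exists2 y, N y & K (z - s * y)].

Lemma ideal_mix K s N : ideal K -> ideal N -> ideal (mix K s N).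
Proof.
move=> iK iN; apply: mk_ideal => [|x y [u Nu Ku] [v Nv Kv]|a x [u Nu Ku]].
- by exists 0; [exact: ideal0 | rewrite mulr0 subr0; exact: ideal0].
- exists (u + v); first exact: idealD.
  by rewrite mulrDr opprD addrACA; exact: idealD.
- exists (a * u); first exact: idealMl.
  by rewrite mulrCA -mulrBr; exact: idealMl.
Qed.

Lemma sub_mix K s N : ideal N -> K `<=` mix K s N.
Proof. by move=> iN x Kx; exists 0; [exact: ideal0 | rewrite mulr0 subr0]. Qed.

Lemma mem_mix K s N y : ideal K -> N y -> mix K s N (s * y).
Proof. by move=> iK Ny; exists y => //; rewrite subrr; exact: ideal0. Qed.

Lemma mix_sub K s N L : ideal L -> K `<=` L -> (forall y, N y -> L (s * y)) ->
  mix K s N `<=` L.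
Proof.
by move=> iL KL NL x [y Ny /KL Lxy]; rewrite -(subrK (s * y) x); apply: idealD => //; exact: NL.
Qed.

End IdealTheory.

(** * Lengths of subquotients of the ring *)

Section Length.
Variable A : comNzRingType.
Implicit Types (I J K L M N P Q : set A) (a b s t w x y z : A).

Definition between K N L := [/\ ideal L, K `<=` L & L `<=` N].

(* Convertible to [has_length] for the submodules [K] and [N] of [A^o]. *)
Definition len_eq K N (n : nat) := max_chain_length (between K N) n.

Definition fin_len K N := exists n, len_eq K N n.

Definition len K N : nat := xget 0%N (len_eq K N).

Lemma lenP K N : fin_len K N -> len_eq K N (len K N).
Proof. by move=> [n Kn]; rewrite /len; case: xgetP => [k -> //|/(_ n)]. Qed.

Lemma lenE K N n : len_eq K N n -> len K N = n.
Proof.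
move=> Kn; apply: max_chain_length_uniq (Kn).
by apply: lenP; exists n.
Qed.

Lemma fin_len_bounded K N p : ideal K -> K `<=` N ->
  (forall k c, strict_chain (between K N) k c -> (k <= p)%N) ->
  exists2 n, len_eq K N n & (n <= p)%N.
Proof.
move=> iK KN ub.
have ex : exists n, `[< exists c, strict_chain (between K N) n c >].
  by exists 0%N; apply/asboolP; exists (fun=> K); split=> // i _; split.
have bd n : `[< exists c, strict_chain (between K N) n c >] -> (n <= p)%N.
  by move=> /asboolP[c]; apply: ub.
exists (ex_maxn ex bd).
  case: ex_maxnP => n /asboolP[c Hc] max; split; first by exists c.
  by move=> k c' Hc'; apply: max; apply/asboolP; exists c'.
by case: ex_maxnP => n /bd.
Qed.

Lemma between_chain_sub K N K' N' k c : K `<=` K' -> N' `<=` N ->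
  strict_chain (between K' N') k c -> strict_chain (between K N) k c.
Proof.
move=> KK NN [Pc ltc]; split=> // i ik; have [icu K'c cN'] := Pc i ik.
by split=> //; [apply: subset_trans K'c | apply: subset_trans NN].
Qed.

Lemma len_sub K N K' N' : ideal K' -> K `<=` K' -> K' `<=` N' -> N' `<=` N ->
  fin_len K N -> fin_len K' N' /\ (len K' N' <= len K N)%N.
Proof.
move=> iK KK KN NN /lenP[_ ub].
have [n Kn len_n] : exists2 n, len_eq K' N' n & (n <= len K N)%N.
  apply: fin_len_bounded => //.
  by move=> k c /(between_chain_sub KK NN); exact: ub.
by split; [exists n | rewrite (lenE Kn)].
Qed.

Lemma len_eqD K M N (a b : nat) : ideal M -> ideal N -> K `<=` M -> M `<=` N ->
  len_eq K M a -> len_eq M N b -> len_eq K N (a + b)%N.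
Proof.
move=> iM iN KM MN Ka Mb; split.
  have [[c [Pc ltc]] _] := Ka; have [[c' [Pc' ltc']] _] := Mb.
  exists (fun i => if (i < a)%N then c i else c' (i - a)%N); split=> [i iab|i iab].
    case: ifP => ia.
      by have [? ? ?] := Pc i (ltnW ia); split=> //; exact: subset_trans MN.
    have iab' : (i - a <= b)%N by lia.
    by have [? ? ?] := Pc' _ iab'; split=> //; exact: subset_trans KM _.
  case: ifP => ia; last first.
    have -> : (i.+1 < a)%N = false by lia.
    rewrite subSn; last lia.
    by apply: ltc'; lia.
  case: ifP => ia'; first exact: ltc.
  have -> : (i.+1 - a = 0)%N by lia.
  have [//|_ _ cM] := Pc a.
  have [//|_ Mc' _] := Pc' 0%N.
  have ai : a = i.+1 by lia.
  have [cc ncc] := ltc i ia; rewrite ai in cM.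
  split; first by apply: subset_trans cc _; apply: subset_trans Mc'.
  by move=> h; apply: ncc; apply: subset_trans cM _; apply: subset_trans h.
move=> k f [Pf ltf].
(* Upper bound by the modular law: a strict step of [f] stays strict in the trace on [M] or in the
   sum with [M], so [k] is at most the number of strict steps of [f1] plus that of [f2]. *)
pose f1 i := f i `&` M; pose f2 i := mix (f i) 1 M.
have mixE i x : f2 i x <-> exists2 y, M y & f i (x - y).
  by split=> -[y My]; rewrite ?mul1r => fy; exists y => //; rewrite mul1r.
have [||c1 Hc1 _] := @weak_chain _ (between K M) f1 k.
- move=> i ik; have [fi Kf fN] := Pf i ik; split; first exact: ideal_setI.
    by move=> x Kx; split; [exact: Kf | exact: KM].
  by move=> x [].
- by move=> i ik x [fx Mx]; split=> //; have [ff _] := ltf i ik; exact: ff.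
have [||c2 Hc2 _] := @weak_chain _ (between M N) f2 k.
- move=> i ik; have [fi Kf fN] := Pf i ik; split; first exact: ideal_mix.
    by move=> x Mx; apply/mixE; exists x => //; rewrite subrr; case: fi.
  apply: mix_sub => //.
  by move=> y My; rewrite mul1r; exact: MN.
- move=> i ik x /mixE[y My fxy]; apply/mixE; exists y => //.
  by have [ff _] := ltf i ik; exact: ff.
have [_ uba] := Ka; have [_ ubb] := Mb.
apply: leq_trans (leq_add (uba _ _ Hc1) (ubb _ _ Hc2)).
rewrite -big_split /= -[leqLHS]card_ord -sum1_card; apply: leq_sum => i _.
case: asboolP => [_|/contrapT e1]; first by case: asboolP.
case: asboolP => // /contrapT e2.
have [ff nff] := ltf i (ltn_ord i).
case: nff => x fx.
have /mixE[y My fy] : f2 i x.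
  by rewrite e2; apply/mixE; exists 0; [exact: ideal0 | rewrite subr0].
have [iS _ _] := Pf i.+1 (ltn_ord i).
have [i0 _ _] := Pf i (ltnW (ltn_ord i)).
have : f1 i y.
  by rewrite e1; split=> //; rewrite -(subKr x y); apply: idealB => //; exact: ff.
by case=> fy' _; rewrite -(subrK y x); exact: idealD.
Qed.

Lemma len_eqxx K : ideal K -> len_eq K K 0.
Proof.
move=> iK; split; first by exists (fun=> K); split=> // i _; split.
move=> [//|k] c [Pc ltc]; have [//|_ Kc0 _] := Pc 0%N; have [//|_ _ cK] := Pc 1%N.
by have [//|_ []] := ltc 0%N; exact: subset_trans cK Kc0.
Qed.

Lemma len_eq_mix K N s n : ideal K -> ideal N ->
  len_eq K (mix K s N) n <-> len_eq (colon K s N) N n.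
Proof.
move=> iK iN.
pose f L := colon L s N; pose g L := mix K s L.
have lef : {homo f : L M / L `<=` M} by move=> L M LM x [Nx /LM].
have leg : {homo g : L M / L `<=` M} by move=> L M LM x [y /LM My Kxy]; exists y.
have Pf L : between K (mix K s N) L -> between (colon K s N) N (f L).
  move=> [iL KL LN]; split; [exact: ideal_colon | exact: lef | by move=> x []].
have Pg L : between (colon K s N) N L -> between K (mix K s N) (g L).
  by move=> [iL KL LN]; split; [exact: ideal_mix | exact: sub_mix | exact: leg].
have fK L : between K (mix K s N) L -> g (f L) = L.
  move=> [iL KL LN]; apply/seteqP; split=> x.
    by apply: mix_sub => // y [].
  move=> Lx; have [y Ny Kxy] := LN x Lx; exists y => //; split=> //.
  by rewrite -(subKr x (s * y)); apply: idealB => //; exact: KL.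
have gK L : between (colon K s N) N L -> f (g L) = L.
  move=> [iL KL LN]; apply/seteqP; split=> x.
    move=> [Nx [y Ly]]; rewrite -mulrBr => Kxy; rewrite -(subrK y x); apply: idealD => //.
    by apply: KL; split=> //; apply: idealB => //; exact: LN.
  by move=> Lx; split; [exact: LN | exact: mem_mix].
split; first exact: (max_chain_length_iso Pf Pg fK gK lef leg).
exact: (max_chain_length_iso Pg Pf gK fK leg lef).
Qed.

End Length.

(** * Products and powers of ideals *)

Section Products.
Variable A : comNzRingType.
Implicit Types (I J K L M N P Q : set A) (a b s t w x y z : A).

Lemma mem_ideal_mul I J a b : I a -> J b -> ideal_mul I J (a * b).
Proof.
by move=> Ia Jb; exists 1%N, (fun=> a), (fun=> b); split=> //; rewrite big_ord1.
Qed.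

Lemma ideal_mul_sub I J K : ideal K -> (forall a b, I a -> J b -> K (a * b)) ->
  ideal_mul I J `<=` K.
Proof.
move=> iK IJK _ [n [a [b [Ia Jb ->]]]].
by apply: ideal_sum => // i _; exact: IJK.
Qed.

Lemma ideal_ideal_mul I J : ideal I -> ideal (ideal_mul I J).
Proof.
move=> iI; apply: mk_ideal.
- by exists 0%N, (fun=> 0), (fun=> 0); split; [case | case | rewrite big_ord0].
- move=> _ _ [n [a [b [Ia Jb ->]]]] [n' [a' [b' [Ia' Jb' ->]]]].
  pose cmb (f : 'I_n -> A) (f' : 'I_n' -> A) (i : 'I_(n + n')) :=
    match fintype.split i with inl j => f j | inr j => f' j end.
  exists (n + n')%N, (cmb a a'), (cmb b b'); rewrite /cmb; split.
  + by move=> i; case: (fintype.split i).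
  + by move=> i; case: (fintype.split i).
  rewrite big_split_ord /=; congr (_ + _); apply: eq_bigr => i _.
    by rewrite -[lshift _ _]/(unsplit (inl i)) unsplitK.
  by rewrite -[rshift _ _]/(unsplit (inr i)) unsplitK.
- move=> c _ [n [a [b [Ia Jb ->]]]].
  exists n, (fun i => c * a i), b; split=> // [i|]; first exact: idealMl.
  by rewrite mulr_sumr; apply: eq_bigr => i _; rewrite mulrA.
Qed.

Lemma ideal_mulC I J : ideal_mul I J = ideal_mul J I.
Proof.
by apply/seteqP; split=> _ [n [a [b [Ia Jb ->]]]]; exists n, b, a; split=> //;
  apply: eq_bigr => i _; rewrite mulrC.
Qed.

Lemma ideal_mulS I I' J J' : I `<=` I' -> J `<=` J' ->
  ideal_mul I J `<=` ideal_mul I' J'.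
Proof.
move=> II JJ _ [n [a [b [Ia Jb ->]]]].
by exists n, a, b; split=> // i; [exact: II | exact: JJ].
Qed.

Lemma ideal_mulA I J K : ideal I -> ideal J -> ideal K ->
  ideal_mul I (ideal_mul J K) = ideal_mul (ideal_mul I J) K.
Proof.
move=> iI iJ iK; apply/seteqP; split.
  apply: ideal_mul_sub => [|a b Ia]; first exact/ideal_ideal_mul/ideal_ideal_mul.
  move=> [n [b1 [b2 [Jb Kb ->]]]]; rewrite mulr_sumr; apply: ideal_sum => [|i _].
    exact/ideal_ideal_mul/ideal_ideal_mul.
  by rewrite mulrA; do 2!apply: mem_ideal_mul => //.
apply: ideal_mul_sub => [|a b [n [a1 [a2 [Ia Ja ->]]]] Kb].
  exact/ideal_ideal_mul.
rewrite mulr_suml; apply: ideal_sum => [|i _]; first exact/ideal_ideal_mul.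
by rewrite -mulrA; do 2!apply: mem_ideal_mul => //.
Qed.

Lemma ideal_mul1 I : ideal I -> ideal_mul setT I = I.
Proof.
move=> iI; apply/seteqP; split; first by apply: ideal_mul_sub => // *; exact: idealMl.
by move=> x Ix; rewrite -[x]mul1r; exact: mem_ideal_mul.
Qed.

Lemma ideal_mul_subr I J : ideal J -> ideal_mul I J `<=` J.
Proof. by move=> iJ; apply: ideal_mul_sub => // a b _; exact: idealMl. Qed.

Lemma ideal_ideal_exp I n : ideal I -> ideal (ideal_exp I n).
Proof. by move=> iI; case: n => // n; exact: ideal_ideal_mul. Qed.

Lemma ideal_exp1 I : ideal I -> ideal_exp I 1 = I.
Proof. by move=> iI; rewrite /= ideal_mulC ideal_mul1. Qed.

Lemma ideal_expD I n k : ideal I ->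
  ideal_exp I (n + k) = ideal_mul (ideal_exp I n) (ideal_exp I k).
Proof.
move=> iI; elim: n => [|n IHn] /=; first by rewrite ideal_mul1 //; exact: ideal_ideal_exp.
by rewrite IHn ideal_mulA //; exact: ideal_ideal_exp.
Qed.

Lemma ideal_expS_sub I n : ideal I -> ideal_exp I n.+1 `<=` ideal_exp I n.
Proof. by move=> iI; apply: ideal_mul_subr; exact: ideal_ideal_exp. Qed.

Lemma ideal_expS I J n : I `<=` J -> ideal_exp I n `<=` ideal_exp J n.
Proof. by move=> IJ; elim: n => //= n IHn; exact: ideal_mulS. Qed.

Lemma ideal_mul_mix L K s N : ideal L -> ideal K -> ideal N ->
  ideal_mul L (mix K s N) = mix (ideal_mul L K) s (ideal_mul L N).
Proof.
move=> iL iK iN; have iLK := ideal_ideal_mul K iL; have iLN := ideal_ideal_mul N iL.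
apply/seteqP; split.
  apply: ideal_mul_sub => [|a b La [y Ny Kby]]; first exact: ideal_mix.
  exists (a * y); first exact: mem_ideal_mul.
  by rewrite mulrCA -mulrBr; exact: mem_ideal_mul.
apply: mix_sub => [||y]; first exact: ideal_ideal_mul.
  by apply: ideal_mulS => //; exact: sub_mix.
move=> [n [a [b [La Nb ->]]]]; rewrite mulr_sumr; apply: ideal_sum => [|i _].
  exact: ideal_ideal_mul.
by rewrite mulrCA; apply: mem_ideal_mul => //; exact: mem_mix.
Qed.

Definition adj K s : set A := mix K s setT.

Lemma ideal_adj K s : ideal K -> ideal (adj K s).
Proof. by move=> iK; exact: ideal_mix. Qed.

Lemma sub_adj K s : K `<=` adj K s.
Proof. exact: sub_mix. Qed.

Lemma mem_adj K s a : ideal K -> adj K s (s * a).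
Proof. by move=> iK; exact: mem_mix. Qed.

Lemma mem_adj1 K s : ideal K -> adj K s s.
Proof. by move=> iK; rewrite -[X in adj _ _ X]mulr1; exact: mem_adj. Qed.

Lemma adj_sub K s L : ideal L -> K `<=` L -> L s -> adj K s `<=` L.
Proof. by move=> iL KL Ls; apply: mix_sub => // y _; exact: idealMr. Qed.

(** A product of [n.+1] elements of [P + (s)] either avoids [s] or releases one factor [s]: the
    ideal counterpart of sorting monomials by divisibility by the last variable. *)
Lemma ideal_exp_adj P s n : ideal P ->
  ideal_exp (adj P s) n.+1 = mix (ideal_exp P n.+1) s (ideal_exp (adj P s) n).
Proof.
move=> iP; set Q := adj P s; have iQ : ideal Q by exact: ideal_adj.
have iQn k : ideal (ideal_exp Q k) by exact: ideal_ideal_exp.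
have iPn k : ideal (ideal_exp P k) by exact: ideal_ideal_exp.
have sub k : mix (ideal_exp P k.+1) s (ideal_exp Q k) `<=` ideal_exp Q k.+1.
  apply: mix_sub => // [|y Qy]; first by apply: ideal_expS; exact: sub_adj.
  by apply: mem_ideal_mul => //; exact: mem_adj1.
apply/seteqP; split=> //; elim: n => [|n IHn].
  rewrite !ideal_exp1 //.
rewrite {1}/ideal_exp -/(ideal_exp Q n.+1); apply: ideal_mul_sub; first exact: ideal_mix.
move=> q x [a _ Pq] /IHn[z Qz Px].
rewrite -[q](subrK (s * a)) -[x in _ * x](subrK (s * z)).
set p := q - s * a in Pq *; set y := x - s * z in Px *.
have -> : (p + s * a) * (y + s * z) = p * y + s * (p * z + a * (y + s * z)) by ring.
apply: idealD; first exact: ideal_mix.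
  by apply: sub_mix => //; exact: mem_ideal_mul.
apply: mem_mix => //; apply: idealD => //.
  by apply: mem_ideal_mul => //; exact: sub_adj.
apply: idealMl => //; apply: sub; rewrite /y subrK.
by exists z.
Qed.

End Products.

(* The number of monomials of degree [n] in [d] variables. *)
Definition nmon (d n : nat) : nat := if d is d'.+1 then 'C(n + d', d') else n == 0%N.

Lemma nmonS0 d : nmon d.+1 0 = 1%N.
Proof. by rewrite /= add0n binn. Qed.

(** Pascal's rule: a monomial is free of the last variable or divisible by it. The inductions on the
    number of variables all follow this split. *)
Lemma nmonSS d n : nmon d.+1 n.+1 = (nmon d n.+1 + nmon d.+1 n)%N.
Proof.
case: d => [|d] /=; first by rewrite !bin0.
by rewrite addSn binS addnC addnS addSn.
Qed.

(** * Powers of an ideal generated by a regular sequence *)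

Section RegularSequences.
Variable A : comNzRingType.
Implicit Types (I J K L M N P Q : set A) (a b s t w x y z : A) (u v : seq A).

(** Adjoining elements one at a time to an arbitrary base [J] lets a sequence be peeled at its head
    by computation and at its tail by [gens_rcons]. *)
Definition gens J u : set A := foldl (@adj A) J u.

Lemma gens_rcons J u s : gens J (rcons u s) = adj (gens J u) s.
Proof. by rewrite /gens foldl_rcons. Qed.

Lemma ideal_gens J u : ideal J -> ideal (gens J u).
Proof. by elim: u J => //= s u IHu J iJ; apply: IHu; exact: ideal_adj. Qed.

Lemma sub_gens J u : J `<=` gens J u.
Proof.
elim: u J => [|s u IHu] J; first exact: subset_refl.
apply: subset_trans (IHu _); exact: sub_adj.
Qed.

Lemma mem_gens J u s : ideal J -> s \in u -> gens J u s.
Proof.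
elim: u J => //= t u IHu J iJ; rewrite inE => /orP[/eqP ->|su].
  by apply: sub_gens; exact: mem_adj1.
by apply: IHu => //; exact: ideal_adj.
Qed.

Lemma gens_sub J u L : ideal L -> J `<=` L -> (forall s, s \in u -> L s) ->
  gens J u `<=` L.
Proof.
elim: u J => //= t u IHu J iL JL uL; apply: IHu => // [|s su].
  by apply: adj_sub => //; apply: uL; rewrite mem_head.
by apply: uL; rewrite inE su orbT.
Qed.

Definition reg J t := forall a, J (t * a) -> J a.

Fixpoint regseq J u : Prop :=
  if u is t :: u' then reg J t /\ regseq (adj J t) u' else True.

Lemma regseq_rcons J u t : regseq J (rcons u t) <-> regseq J u /\ reg (gens J u) t.
Proof.
elim: u J => /= [|s u IHu] J; first by split=> -[].
by rewrite IHu /=; split=> [[? []]|[[? ?] ?]].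
Qed.

(* With P generated by the regular sequence [u], P^n/P^n J is a direct sum of copies of
   A/J; this is the consequence of that fact that avoids direct sums. *)
Lemma reg_gens_exp u J t n a : regseq [set 0] u -> ideal J ->
    gens [set 0] u `<=` J -> reg J t ->
    ideal_exp (gens [set 0] u) n a ->
    ideal_mul (ideal_exp (gens [set 0] u) n) J (t * a) ->
  ideal_mul (ideal_exp (gens [set 0] u) n) J a.
Proof.
have i0 := @ideal_set0 A.
elim/last_ind: u J t n a => [|u s IHu] J t n a.
  move=> _ iJ _ regt; case: n => [_|n].
    by rewrite /= !ideal_mul1 //; exact: regt.
  move=> Ha _; have -> : [set 0] a.
    by apply: ideal_mul_sub Ha => // b c -> _; rewrite mul0r.
  by apply: ideal0; apply: ideal_ideal_mul; exact: ideal_ideal_exp.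
rewrite gens_rcons => /regseq_rcons[regu regs] iJ QJ regt.
set P := gens _ u in IHu regs QJ *.
have iP : ideal P by exact: ideal_gens.
have PJ : P `<=` J by apply: subset_trans QJ; exact: sub_adj.
(* The outer induction with [J := P] makes [s] regular on each quotient of consecutive powers of
   [P], hence modulo every power. *)
have regsP k b : ideal_exp P k (s * b) -> ideal_exp P k b.
  elim: k b => // k IHk b Psb.
  rewrite /= ideal_mulC; apply: (IHu P s) => //; last by rewrite ideal_mulC.
  by apply: IHk; exact: (ideal_expS_sub iP Psb).
set Q := adj P s in QJ *; have iQ : ideal Q by exact: ideal_adj.
have iPn k : ideal (ideal_exp P k) by exact: ideal_ideal_exp.
have iQn k : ideal (ideal_exp Q k) by exact: ideal_ideal_exp.
have iPJ k : ideal (ideal_mul (ideal_exp P k) J) by exact: ideal_ideal_mul.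
have iQJ k : ideal (ideal_mul (ideal_exp Q k) J) by exact: ideal_ideal_mul.
have PQJ k : ideal_exp P k.+1 `<=` ideal_mul (ideal_exp Q k) J.
  rewrite /= ideal_mulC; apply: ideal_mulS PJ.
  by apply: ideal_expS; exact: sub_adj.
have QSJ k : ideal_mul (ideal_exp Q k.+1) J =
    mix (ideal_mul (ideal_exp P k.+1) J) s (ideal_mul (ideal_exp Q k) J).
  by rewrite ideal_exp_adj // ideal_mulC ideal_mul_mix // ![ideal_mul J _]ideal_mulC.
elim: n a => [|n IHn] a; first by move=> _; rewrite /= !ideal_mul1 //; exact: regt.
rewrite {1}ideal_exp_adj // => -[a1 Qa1 Pa0]; rewrite QSJ => -[b Qb Pp].
set a0 := a - s * a1 in Pa0 *; set p := t * a - s * b in Pp.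
have aE : a = a0 + s * a1 by rewrite /a0 subrK.
have pE : p = t * a0 + s * (t * a1 - b) by rewrite /p aE; ring.
(* Since [p] and [t * a0] lie in [P^n.+1], so does [s * (t * a1 - b)], and [s] cancels. This puts
   [t * a1] in [Q^n J], for the inner induction, and [t * a0] in [P^n.+1 J], for the outer one. *)
have Psb : ideal_exp P n.+1 (t * a1 - b).
  apply: regsP; rewrite -[X in ideal_exp _ _ X](addKr (t * a0)) -pE addrC.
  apply: idealB => //; last exact: idealMl.
  by move: Pp; apply: ideal_mul_sub => // x y Px _; exact: idealMr.
rewrite aE; apply: idealD; first by rewrite -QSJ.
  apply: sub_mix => //; apply: (IHu J t) => //.
  rewrite -[t * a0](addrK (s * (t * a1 - b))) -pE; apply: idealB => //.
  by rewrite mulrC; apply: mem_ideal_mul => //; apply: QJ; exact: mem_adj1.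
apply: mem_mix => //; apply: IHn => //.
rewrite -[t * a1](subrK b); apply: idealD => //; exact: PQJ.
Qed.

Lemma reg_exp u t n : regseq [set 0] u -> reg (gens [set 0] u) t ->
  reg (ideal_exp (gens [set 0] u) n) t.
Proof.
move=> regu regt; have i0 := @ideal_set0 A.
have iP : ideal (gens [set 0] u) by exact: ideal_gens.
elim: n => // n IHn a Pta.
rewrite /= ideal_mulC; apply: (reg_gens_exp regu iP _ regt) => //; last by rewrite ideal_mulC.
by apply: IHn; exact: (ideal_expS_sub iP Pta).
Qed.

Lemma len_eq_gens_exp u J l n : regseq [set 0] u -> ideal J ->
    gens [set 0] u `<=` J -> len_eq J setT l ->
  len_eq (ideal_mul (ideal_exp (gens [set 0] u) n) J) (ideal_exp (gens [set 0] u) n)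
    (l * nmon (size u) n)%N.
Proof.
have i0 := @ideal_set0 A.
elim/last_ind: u J n => [|u s IHu] J n.
  move=> _ iJ _ Jl; case: n => [|n]; first by rewrite /= ideal_mul1 // muln1.
  rewrite muln0.
  have -> : ideal_exp (gens [set 0] [::]) n.+1 = [set 0].
    apply/seteqP; split=> [|_ ->]; last by apply: ideal0; exact: ideal_ideal_exp.
    by apply: ideal_mul_sub => // a b -> _; rewrite mul0r.
  have -> : ideal_mul [set 0] J = [set 0].
    apply/seteqP; split=> [|_ ->]; last by apply: ideal0; exact: ideal_ideal_mul.
    by apply: ideal_mul_sub => // a b -> _; rewrite mul0r.
  exact: len_eqxx.
rewrite gens_rcons size_rcons => /regseq_rcons[regu regs] iJ QJ Jl.
set P := gens _ u in IHu regs QJ *.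
have iP : ideal P by exact: ideal_gens.
have PJ : P `<=` J by apply: subset_trans QJ; exact: sub_adj.
have regsP k : reg (ideal_exp P k) s by exact: reg_exp.
set Q := adj P s in QJ *; have iQ : ideal Q by exact: ideal_adj.
have iPn k : ideal (ideal_exp P k) by exact: ideal_ideal_exp.
have iQn k : ideal (ideal_exp Q k) by exact: ideal_ideal_exp.
have iPJ k : ideal (ideal_mul (ideal_exp P k) J) by exact: ideal_ideal_mul.
have iQJ k : ideal (ideal_mul (ideal_exp Q k) J) by exact: ideal_ideal_mul.
have PQJ k : ideal_exp P k.+1 `<=` ideal_mul (ideal_exp Q k) J.
  rewrite /= ideal_mulC; apply: ideal_mulS PJ.
  by apply: ideal_expS; exact: sub_adj.
have QSJ k : ideal_mul (ideal_exp Q k.+1) J =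
    mix (ideal_mul (ideal_exp P k.+1) J) s (ideal_mul (ideal_exp Q k) J).
  by rewrite ideal_exp_adj // ideal_mulC ideal_mul_mix // ![ideal_mul J _]ideal_mulC.
elim: n => [|n IHn]; first by rewrite nmonS0 muln1 /= ideal_mul1.
rewrite nmonSS mulnDr addnC.
have subT k : ideal_mul (ideal_exp Q k) J `<=` ideal_exp Q k.
  by rewrite ideal_mulC; exact: ideal_mul_subr.
have Js : J s by apply: QJ; exact: mem_adj1.
(* [M] lies between [Q^n.+1 J] and [Q^n.+1]. Multiplication by [s] identifies the lower quotient
   with [Q^n / Q^n J], and the upper one is [P^n.+1 / P^n.+1 J]: the two terms of Pascal's rule. *)
pose M := mix (ideal_mul (ideal_exp P n.+1) J) s (ideal_exp Q n).
have iM : ideal M by exact: ideal_mix.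
have MQ : M = mix (ideal_mul (ideal_exp Q n.+1) J) s (ideal_exp Q n).
  apply/seteqP; split; apply: mix_sub => //; try exact: ideal_mix.
  - apply: subset_trans (@sub_mix _ _ _ _ _) => //.
    apply: ideal_mulS => //; apply: ideal_expS; exact: sub_adj.
  - by move=> y Qy; exact: mem_mix.
  - rewrite QSJ; apply: mix_sub => //; first exact: sub_mix.
    by move=> y /subT Qy; exact: mem_mix.
  - by move=> y Qy; exact: mem_mix.
apply: (len_eqD iM) => //.
- by rewrite MQ; exact: sub_mix.
- rewrite ideal_exp_adj //; apply: mix_sub => //.
  + exact: ideal_mix.
  + apply: subset_trans (@sub_mix _ _ _ _ _) => //.
    by rewrite ideal_mulC; exact: ideal_mul_subr.
  + by move=> y Qy; exact: mem_mix.
- rewrite MQ; apply/len_eq_mix => //.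
  suff -> : colon (ideal_mul (ideal_exp Q n.+1) J) s (ideal_exp Q n) =
    ideal_mul (ideal_exp Q n) J by [].
  apply/seteqP; split=> [a [Qa]|a Qa]; last first.
    by split; [exact: subT | rewrite QSJ; exact: mem_mix].
  rewrite QSJ => -[b Qb]; rewrite -mulrBr => Pab.
  rewrite -(subrK b a); apply: idealD => //; apply: PQJ; apply: regsP.
  by move: Pab; rewrite ideal_mulC; exact: ideal_mul_subr.
have -> : ideal_exp Q n.+1 = mix M 1 (ideal_exp P n.+1).
  rewrite ideal_exp_adj //; apply/seteqP; split; apply: mix_sub => //;
    try exact: ideal_mix.
  - by move=> x Px; rewrite -[x]mul1r; exact: mem_mix.
  - by move=> y Qy; apply: sub_mix => //; exact: mem_mix.
  - apply: mix_sub => // [||y Qy]; [exact: ideal_mix| |exact: mem_mix].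
    apply: subset_trans (@sub_mix _ _ _ _ _) => //.
    by rewrite ideal_mulC; exact: ideal_mul_subr.
  - by move=> y Py; rewrite mul1r; exact: sub_mix.
apply/len_eq_mix => //.
suff -> : colon M 1 (ideal_exp P n.+1) = ideal_mul (ideal_exp P n.+1) J by exact: IHu.
apply/seteqP; split=> [a [Pa]|a Pa]; last first.
  split; first by move: Pa; rewrite ideal_mulC; exact: ideal_mul_subr.
  by rewrite mul1r; exact: sub_mix.
rewrite mul1r => -[y Qy Pay]; rewrite -(subrK (s * y) a); apply: idealD => //.
rewrite mulrC; apply: mem_ideal_mul => //; apply: regsP.
rewrite -(subKr a (s * y)); apply: idealB => //.
by move: Pay; rewrite ideal_mulC; exact: ideal_mul_subr.
Qed.

End RegularSequences.

(* The bound satisfied by the Hilbert function of a proper graded quotient of a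
   polynomial ring in [d] variables having a monomial of degree [b] in its initial ideal. *)
Definition deficient (d b : nat) (f : nat -> nat) :=
  forall n, (f n + (if b <= n then nmon d (n - b) else 0) <= nmon d n)%N.

Lemma nmon0 d : nmon d 0 = 1%N.
Proof. by case: d => // d; rewrite nmonS0. Qed.

Lemma deficient_le d b f n : deficient d b f -> (f n <= nmon d n)%N.
Proof. by move=> /(_ n); apply: leq_trans; exact: leq_addr. Qed.

(** * Hilbert functions of cyclic modules, one variable at a time *)

Section PascalRecursion.
(** Intended reading: [f i] is the Hilbert function of the submodule generated by [s ^+ i * w], with
    degrees counted from that generator, and [a i] is that of its quotient by the submodule
    generated by [s ^+ i.+1 * w]. *)
Variables (d : nat) (a f : nat -> nat -> nat).
Hypothesis f0 : forall i, f i 0 = a i 0.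
Hypothesis fS : forall i n, f i n.+1 = (a i n.+1 + f i.+1 n)%N.

Lemma pascal_full : (forall i n, a i n = nmon d n) -> forall n i, f i n = nmon d.+1 n.
Proof.
move=> an; elim=> [|n IHn] i; first by rewrite f0 an nmon0 nmonS0.
by rewrite fS an IHn nmonSS.
Qed.

Lemma pascal_le : (forall i n, (a i n <= nmon d n)%N) ->
  forall n i, (f i n <= nmon d.+1 n)%N.
Proof.
move=> an; elim=> [|n IHn] i; first by rewrite f0 nmonS0 -(nmon0 d).
by rewrite fS nmonSS leq_add.
Qed.

Lemma pascal_deficient b : (forall i, deficient d b (a i)) ->
  forall i, deficient d.+1 b (f i).
Proof.
move=> ab i n; elim: n i => [|n IHn] i.
  by have := ab i 0%N; rewrite f0 nmonS0 nmon0; case: ifP.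
have := leq_add (ab i n.+1) (IHn i.+1); rewrite fS nmonSS; apply: leq_trans.
rewrite -!addnA leq_add2l addnCA leq_add2l.
case: (leqP b n) => bn; first by rewrite leqW // subSn // nmonSS.
rewrite addn0; case: ifP => // bn'.
have -> : (n.+1 - b = 0)%N by lia.
by rewrite nmonS0 nmon0.
Qed.

(** A monomial of degree [b] missing after [s ^+ i.+1] gives, multiplied by [s], one of degree
    [b.+1] missing after [s ^+ i]; the layer [a i] itself only has to satisfy the trivial bound. *)
Lemma pascal_deficient_pred b i : (forall i n, (a i n <= nmon d n)%N) ->
  deficient d.+1 b (f i.+1) -> deficient d.+1 b.+1 (f i).
Proof.
move=> an fb [|n]; first by rewrite ltn0 addn0; exact: pascal_le.
by rewrite fS nmonSS ltnS subSS -addnA leq_add.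
Qed.

End PascalRecursion.

(** The finitely many layers below [i0] may be full: descending from [i0] to 0 costs one degree per
    layer, so the gap found is [b + i0]. *)
Lemma pascal_deficient0 d (a f : nat -> nat -> nat) b i0 :
    (forall i, f i 0%N = a i 0%N) -> (forall i n, f i n.+1 = (a i n.+1 + f i.+1 n)%N) ->
    (forall i n, (a i n <= nmon d n)%N) ->
    (forall i, (i0 <= i)%N -> deficient d b (a i)) ->
  exists b', deficient d.+1 b' (f 0%N).
Proof.
move=> f0 fS an ab; suff: forall k, (k <= i0)%N -> exists b', deficient d.+1 b' (f (i0 - k)%N).
  by move=> /(_ i0 (leqnn _)); rewrite subnn.
elim=> [_|k IHk ki0].
  exists b; rewrite subn0.
  have := @pascal_deficient d (fun i => a (i + i0)%N) (fun i => f (i + i0)%N) _ _ b _ 0%N.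
  by apply => [i|i n|i] //=; apply: ab; exact: leq_addl.
have [b' fb] := IHk (ltnW ki0).
exists b'.+1; apply: (pascal_deficient_pred f0 fS an).
by have -> : (i0 - k.+1).+1 = (i0 - k)%N by lia.
Qed.

Section Cyclic.
Variable A : comNzRingType.
Implicit Types (I J K L M N P Q m : set A) (a b s t w x y z : A) (u v : seq A).

Lemma maximal_ideal_eq m J : maximal_ideal m -> ideal J -> m `<=` J -> ~ J 1 -> J = m.
Proof. by case=> _ _; apply. Qed.

Lemma len_eq_maximal m : maximal_ideal m -> len_eq m setT 1.
Proof.
move=> mm; have [im m1 _] := mm; split.
  exists (fun i => if i is 0%N then m else setT); split=> [[|i] _|[|i] //= _].
  - by split.
  - by split.
  - by split=> // /(_ 1 I).
move=> [|[|k]] // c [Pc ltc].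
have [//|_ mc0 _] := Pc 0%N; have [//|i1 mc1 _] := Pc 1%N.
have [//|_ n01] := ltc 0%N; have [//|_ n12] := ltc 1%N.
case: n01; suff -> : c 1%N = m by [].
apply: maximal_ideal_eq => // c1; apply: n12 => x _.
by rewrite -[x]mulr1; exact: idealMl.
Qed.

(* The graded pieces of the cyclic module generated by [w], filtered by the powers of
   the last variable [s]: the subquotient at [s ^+ i] is cyclic over one variable fewer,
   and surjects onto the one at [s ^+ i.+1]. *)
Lemma cyclic_dichotomy m u (D : nat -> set A) w : maximal_ideal m ->
    gens [set 0] u `<=` m ->
    (forall n, ideal (D n)) ->
    (forall n x y, gens [set 0] u x -> D n y -> D n.+1 (x * y)) ->
    (forall x, m x -> D 0%N (w * x)) ->
  exists2 f, (forall n, len_eq (D n) (mix (D n) w (ideal_exp (gens [set 0] u) n)) (f n))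
    & (forall n, f n = nmon (size u) n) \/ exists k, deficient (size u) k f.
Proof.
move=> mm; have i0 := @ideal_set0 A.
elim/last_ind: u D w => [|u s IHu] D w um iD uD mw.
  have exp0 n : ideal_exp (gens [set 0] [::]) n.+1 = [set 0] :> set A.
    apply/seteqP; split=> [|_ ->]; last by apply: ideal0; exact: ideal_ideal_exp.
    by apply: ideal_mul_sub => // a b -> _; rewrite mul0r.
  have mix0 n : mix (D n) w [set 0] = D n.
    apply/seteqP; split; last exact: sub_mix.
    by apply: mix_sub => // y ->; rewrite mulr0; exact: ideal0.
  have [Dw|nDw] := pselect (D 0%N w).
    exists (fun=> 0%N); last by right; exists 0%N => n; rewrite subn0.
    case=> [|n]; last by rewrite exp0 mix0; exact: len_eqxx.
    suff -> : mix (D 0%N) w setT = D 0%N by exact: len_eqxx.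
    apply/seteqP; split; last exact: sub_mix.
    by apply: mix_sub => // y _; exact: idealMr.
  exists (nmon 0); last by left.
  case=> [|n]; last by rewrite exp0 mix0; exact: len_eqxx.
  apply/len_eq_mix => //; suff -> : colon (D 0%N) w setT = m by exact: len_eq_maximal.
  apply: maximal_ideal_eq => //; first exact: ideal_colon.
    by move=> x mx; split=> //; exact: mw.
  by case=> _; rewrite mulr1.
rewrite gens_rcons size_rcons in um uD *.
set P := gens _ u in IHu um uD *; set Q := adj P s in um uD *; set d := size u in IHu *.
have iP : ideal P by exact: ideal_gens.
have iQ : ideal Q by exact: ideal_adj.
have iPn k : ideal (ideal_exp P k) by exact: ideal_ideal_exp.
have iQn k : ideal (ideal_exp Q k) by exact: ideal_ideal_exp.
have PQ : P `<=` Q by exact: sub_adj.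
have Qs : Q s by exact: mem_adj1.
(* [E i n] below is the part of degree [n + i] of the relations enlarged by the multiples of
   [W i.+1]. That element has degree [i.+1], so it is multiplied by [Q^(n-1)], and by nothing when
   [n = 0]. Modulo [E i], only the variables in [u] act on [W i]. *)
pose pQ n := if n is n'.+1 then ideal_exp Q n' else [set 0] : set A.
have ipQ n : ideal (pQ n) by case: n => //.
pose W i := s ^+ i * w.
pose E i n := mix (D (n + i)%N) (W i.+1) (pQ n).
have iE i n : ideal (E i n) by exact: ideal_mix.
have sE i n x : E i n x -> E i.+1 n (s * x).
  move=> [y Qy Dy]; exists y => //; rewrite addnS.
  have -> : s * x - W i.+2 * y = s * (x - W i.+1 * y) by rewrite /W exprS; ring.
  exact: uD.
have mW i x : m x -> D i (W i * x).
  move=> mx; elim: i => [|i IHi]; first by rewrite /W expr0 mul1r; exact: mw.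
  have -> : W i.+1 * x = s * (W i * x) by rewrite /W exprS; ring.
  exact: uD.
have PE i n x y : P x -> E i n y -> E i n.+1 (x * y).
  move=> Px [z pQz Dz]; exists (x * z).
    case: n {Dz} pQz => [|n] /= Qz; first by [].
    by apply: mem_ideal_mul => //; exact: PQ.
  have -> : x * y - W i.+1 * (x * z) = x * (y - W i.+1 * z) by ring.
  by apply: uD => //; exact: PQ.
have mE i x : m x -> E i 0%N (W i * x).
  by move=> mx; apply: sub_mix => //; exact: mW.
have /choice[a Ha] i : exists f,
    (forall n, len_eq (E i n) (mix (E i n) (W i) (ideal_exp P n)) (f n))
    /\ ((forall n, f n = nmon d n) \/ exists k, deficient d k f).
  have [f Hf Hf'] := IHu (E i) (W i) (subset_trans PQ um) (iE i) (PE i) (mE i).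
  by exists f.
have Ea i n := (Ha i).1 n; have {}Ha i := (Ha i).2.
have EQ i n : mix (E i n) (W i) (ideal_exp P n) = mix (D (n + i)%N) (W i) (ideal_exp Q n).
  apply/seteqP; split.
    apply: mix_sub => [||y Py]; first exact: ideal_mix.
      apply: mix_sub => [||y]; [exact: ideal_mix | exact: sub_mix |].
      case: n => [->|n Qy] /=; first by rewrite mulr0; apply: ideal0; exact: ideal_mix.
      have -> : W i.+1 * y = W i * (s * y) by rewrite /W exprS; ring.
      by apply: mem_mix => //; exact: mem_ideal_mul.
    by apply: mem_mix => //; apply: ideal_expS Py.
  apply: mix_sub => [||y Qy]; first exact: ideal_mix.
    by apply: subset_trans (@sub_mix _ _ _ _ _) => //; exact: sub_mix.
  case: n Qy => [_|n]; first exact: mem_mix.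
  rewrite ideal_exp_adj // => -[z Qz Pyz].
  have -> : W i * y = W i * (y - s * z) + W i.+1 * z by rewrite /W exprS; ring.
  apply: idealD; [exact: ideal_mix | exact: mem_mix |].
  by apply: sub_mix => //; exact: mem_mix.
pose f := fix f i n := (a i n + if n is n'.+1 then f i.+1 n' else 0)%N.
have f0 i : f i 0%N = a i 0%N by rewrite /= addn0.
have fS i n : f i n.+1 = (a i n.+1 + f i.+1 n)%N by [].
have Df n i : len_eq (D (n + i)%N) (mix (D (n + i)%N) (W i) (ideal_exp Q n)) (f i n).
  elim: n i => [|n IHn] i; rewrite -EQ.
    have E0 : E i 0%N = D (0 + i)%N.
      apply/seteqP; split; last exact: sub_mix.
      by apply: mix_sub => // y ->; rewrite mulr0; exact: ideal0.
    by rewrite f0 -{1}E0; exact: Ea.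
  rewrite fS [(a _ _ + _)%N]addnC; apply: (len_eqD (iE i n.+1) _ _ _ _ (Ea i n.+1)).
  - exact: ideal_mix.
  - exact: sub_mix.
  - exact: sub_mix.
  - by have := IHn i.+1; rewrite addnS.
(* Multiplication by [s] turns relations of [W i] into relations of [W i.+1], so the colon ideals
   grow with [i]. Hence one deficient layer makes all later layers deficient with the same gap. *)
have leS i n : (a i.+1 n <= a i n)%N.
  have /len_eq_mix h1 := Ea i n; have /len_eq_mix h2 := Ea i.+1 n.
  rewrite -(lenE (h1 _ _)) // -(lenE (h2 _ _)) //.
  have [] // := @len_sub _ (colon (E i n) (W i) (ideal_exp P n)) (ideal_exp P n)
    (colon (E i.+1 n) (W i.+1) (ideal_exp P n)) (ideal_exp P n).
  - exact: ideal_colon.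
  - move=> x [Px /sE Ex]; split=> //; move: Ex.
    by have -> : s * (W i * x) = W i.+1 * x by rewrite /W exprS; ring.
  - by move=> x [].
  - by exists (a i n); apply: h1.
have an i n : (a i n <= nmon d n)%N.
  by case: (Ha i) => [->//|[b]]; exact: deficient_le.
exists (f 0%N) => [n|].
  by have := Df n 0%N; rewrite addn0 /W expr0 mul1r.
have [full|/existsNP[i0' nfull]] := pselect (forall i n, a i n = nmon d n).
  by left => n; exact: (pascal_full f0 fS).
right; case: (Ha i0') => [//|[b defb]].
apply: (@pascal_deficient0 d a f b i0') => // i.
elim: i => [|i IHi]; first by rewrite leqn0 => /eqP <-.
rewrite leq_eqVlt => /orP[/eqP <- //|ii] n; apply: leq_trans (IHi ii n).
by rewrite leq_add2r.
Qed.

End Cyclic.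

Lemma ideal_genE (A : comNzRingType) (s : seq A) : ideal_gen s = gens [set 0] s.
Proof.
have i0 := @ideal_set0 A; apply/seteqP; split.
  move=> _ [c ->]; apply: ideal_sum => [|i _]; first exact: ideal_gens.
  by apply: idealMl; [exact: ideal_gens | apply: mem_gens => //; exact: mem_nth].
have ig : ideal (ideal_gen s).
  apply: mk_ideal.
  - by exists (fun=> 0); rewrite big1 // => i _; rewrite mul0r.
  - move=> _ _ [c ->] [c' ->]; exists (fun i => c i + c' i).
    by rewrite -big_split; apply: eq_bigr => i _; rewrite mulrDl.
  - move=> a _ [c ->]; exists (fun i => a * c i).
    by rewrite mulr_sumr; apply: eq_bigr => i _; rewrite mulrA.
apply: gens_sub => // [_ ->|x /(nthP 0)[i si <-]]; first exact: ideal0.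
exists (fun j => (j == Ordinal si)%:R).
rewrite (bigD1 (Ordinal si)) //= eqxx mul1r big1 ?addr0 // => j /negPf ->.
by rewrite mul0r.
Qed.

Lemma pigeonhole (T : eqType) (h : nat -> T) (zs : seq T) d :
    (forall n, h n \in zs) ->
  exists z, z \in zs /\ exists2 ns, uniq ns /\ size ns = d & forall n, n \in ns -> h n = z.
Proof.
elim: zs h => [|z zs IHzs] h hz; first by have := hz 0%N.
have [inf|/existsNP[N fin]] := pselect (forall N, exists2 n, (N <= n)%N & h n = z).
  exists z; split; first exact: mem_head.
  elim: (d) => [|d' [ns [uns sns] hns]]; first by exists [::].
  have [n ltn hn] := inf (\max_(i <- ns) i).+1.
  exists (n :: ns); last by move=> k; rewrite inE => /orP[/eqP ->|/hns].
  split; rewrite /= ?sns // uns andbT; apply/negP => nns.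
  by have := leq_bigmax_seq (F := id) n nns isT; rewrite leqNgt ltn.
have [n|z' [z'zs [ns [uns sns] hns]]] := IHzs (fun n => h (N + n)%N).
  have := hz (N + n)%N; rewrite inE => /orP[/eqP hn|//].
  by case: fin; exists (N + n)%N; rewrite ?leq_addr.
exists z'; split; first by rewrite inE z'zs orbT.
exists [seq (N + n)%N | n <- ns]; last by move=> _ /mapP[n /hns hn ->].
by split; rewrite ?size_map // map_inj_uniq //; exact: addnI.
Qed.

(** * Zero divisors modulo an ideal of a Noetherian ring *)

Section Noetherian.
Variable A : comNzRingType.
Implicit Types (I J K L M N P Q Z : set A) (a b s t w x y z : A) (u v : seq A).

Definition invertible x := exists y, x * y = 1.

Lemma invertibleM x y : invertible x -> invertible y -> invertible (x * y).
Proof.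
move=> [x' xx] [y' yy]; exists (x' * y').
by rewrite mulrACA xx yy mulr1.
Qed.

Lemma invertible_cancel K x y : ideal K -> invertible x -> K (x * y) -> K y.
Proof.
move=> iK [x' xx] Kxy; rewrite -[y]mul1r -xx mulrAC mulrC; exact: idealMl.
Qed.

(** The adjugate of the Vandermonde matrix expresses [\det V * s k] through the given combinations,
    and the determinant is a product of invertible differences. *)
Lemma vandermonde_mem K d (c s : 'I_d -> A) : ideal K ->
    (forall i j, i != j -> invertible (c i - c j)) ->
    (forall i, K (\sum_(j < d) c i ^+ j * s j)) ->
  forall k, K (s k).
Proof.
move=> iK cU Ks k.
pose V := Vandermonde d (\row_i c i).
have V_inv : invertible (\det V).
  rewrite det_Vandermonde; apply: big_ind; [|exact: invertibleM|].
    by exists 1; rewrite mulr1.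
  move=> i _; apply: big_ind; [|exact: invertibleM|].
    by exists 1; rewrite mulr1.
  by move=> j ij; rewrite !mxE; apply: cU; rewrite eq_sym -(inj_eq val_inj) neq_ltn ij.
apply: (invertible_cancel iK V_inv); rewrite -det_tr.
have := congr1 (fun B : 'M_d => (B *m \col_j s j) k 0) (mul_adj_mx V^T).
rewrite mul_scalar_mx -mulmxA ![in RHS]mxE => <-.
rewrite mxE; apply: ideal_sum => // i _; apply: idealMl => //.
rewrite mxE; under eq_bigr do rewrite !mxE; exact: Ks.
Qed.

Lemma noetherian_max (F : set (set A)) J0 : noetherian A ->
    (forall J, F J -> ideal J) -> F J0 ->
  exists2 J, F J & forall J', F J' -> J `<=` J' -> J' = J.
Proof.
move=> nA iF F0; apply: contrapT => nmax.
have next J : exists J', F J -> [/\ F J', J `<=` J' & J' <> J].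
  have [FJ|] := pselect (F J); last by exists J.
  apply: contrapT => nJ; apply: nmax; exists J => // J' FJ' JJ'.
  by apply: contrapT => neq; apply: nJ; exists J'.
have [f Hf] := choice next.
pose C n := iter n f J0.
have FC n : F (C n) by elim: n => //= n /Hf[].
have leC n k : (n <= k)%N -> C n `<=` C k.
  elim: k => [|k IHk]; first by rewrite leqn0 => /eqP ->.
  rewrite leq_eqVlt => /orP[/eqP -> //|/IHk nk].
  by apply: subset_trans nk _; have [] := Hf _ (FC k).
pose U := [set x | exists n, C n x].
have iU : ideal U.
  apply: mk_ideal => [|x y [n Cx] [k Cy]|a x [n Cx]].
  - by exists 0%N; apply: ideal0; exact: iF.
  - exists (maxn n k); apply: idealD; first exact: iF.
      by apply: leC Cx; exact: leq_maxl.
    by apply: leC Cy; exact: leq_maxr.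
  - by exists n; apply: idealMl => //; exact: iF.
have [s Us] := nA U iU.
have [N sN] : exists N : nat, forall x, x \in s -> C N x.
  have : forall x, x \in s -> U x by move=> x xs; rewrite Us ideal_genE; apply: mem_gens => //; exact: ideal_set0.
  elim: s {Us} => [|x s IHs] sU; first by exists 0%N.
  have [|N sN] := IHs; first by move=> y ys; apply: sU; rewrite inE ys orbT.
  have [k Cx] := sU x (mem_head _ _).
  exists (maxn N k) => y; rewrite inE => /orP[/eqP ->|/sN Cy].
    by apply: leC Cx; exact: leq_maxr.
  by apply: leC Cy; exact: leq_maxl.
have [FN CN neq] := Hf _ (FC N).
apply: neq; apply/seteqP; split=> // x Cx.
have : U x by exists N.+1.
rewrite Us ideal_genE; apply: gens_sub => //; first exact: iF.
by move=> _ ->; apply: ideal0; exact: iF.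
Qed.

(* The [z] are chosen with maximal annihilators mod [J]: these are prime, and only finitely
   many occur because any such [z] lies in the ideal generated by finitely many of them. *)
Lemma zero_divisors_finite J : noetherian A -> ideal J ->
  exists2 zs : seq A, (forall z, z \in zs -> ~ J z) &
    forall x, ~ reg J x -> exists2 z, z \in zs & J (x * z).
Proof.
move=> nA iJ.
pose ann z : set A := [set x | J (x * z)].
have iann z : ideal (ann z).
  rewrite (_ : ann z = colon J z setT); first exact: ideal_colon.
  by apply/seteqP; split=> x /=; rewrite /ann /colon /= [z * x]mulrC // => -[].
pose amax z := ~ J z /\ forall z', ~ J z' -> ann z `<=` ann z' -> ann z' = ann z.
have amax_prime z x y : amax z -> J (x * y * z) -> J (x * z) \/ J (y * z).
  move=> [nz maxz] Jxyz; have [|nyz] := pselect (J (y * z)); [by right | left].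
  suff -> : J (x * z) = ann (y * z) x by rewrite /ann /= mulrA.
  rewrite maxz // => t Jtz; rewrite /ann /= mulrCA; exact: idealMl.
have ex_amax z : ~ J z -> exists2 z', amax z' & ann z `<=` ann z'.
  move=> nz.
  pose F := [set K | exists z', [/\ ~ J z', ann z `<=` ann z' & K = ann z']].
  have [||K [z' [nz' zz' ->]] maxz'] := @noetherian_max F (ann z) nA.
  - by move=> _ [z' [_ _ ->]].
  - by exists z; split=> //; exact: subset_refl.
  - exists z' => //; split=> // z'' nz'' z'z''; apply: maxz' => //.
    by exists z''; split=> //; exact: subset_trans z'z''.
have i0 := @ideal_set0 A.
pose F := [set K | exists2 zs : seq A, (forall z, z \in zs -> amax z) & K = gens [set 0] zs].
have [||G [zs zsmax ->] maxG] := @noetherian_max F [set 0] nA.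
- by move=> _ [zs _ ->]; exact: ideal_gens.
- by exists [::].
exists zs => [z /zsmax[]//|x nregx].
have [a Jxa nJa] : exists2 a, J (x * a) & ~ J a.
  apply: contrapT => H; apply: nregx => a Jxa; apply: contrapT => nJa.
  by apply: H; exists a.
have [z zmax az] := ex_amax a nJa.
have Gz : gens [set 0] zs z.
  rewrite -(maxG (gens [set 0] (rcons zs z))).
  - by rewrite gens_rcons; apply: mem_adj1; exact: ideal_gens.
  - exists (rcons zs z) => // y; rewrite mem_rcons inE => /orP[/eqP ->//|]; exact: zsmax.
  - by rewrite gens_rcons; exact: sub_adj.
(* Otherwise each element of [zs] has an annihilator outside [ann z]. As [ann z] is prime, the
   product [b] of these stays outside, yet it kills [zs] and therefore [z], which [zs] generates. *)
have [z' z'zs z'z] : exists2 z', z' \in zs & ann z' `<=` ann z.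
  apply: contrapT => H.
  have [b nb bzs] : exists2 b, ~ J (b * z) & forall y, y \in zs -> J (b * y).
    have {}H y : y \in zs -> exists2 b, J (b * y) & ~ J (b * z).
      move=> yzs; apply: contrapT => H'; apply: H; exists y => // b Jby.
      by apply: contrapT => nJ; apply: H'; exists b.
    elim: zs H {zsmax maxG Gz} => [|y zs IHzs] H.
      by exists 1 => //; rewrite mul1r; case: zmax.
    have [|b nb bzs] := IHzs; first by move=> y' y'zs; apply: H; rewrite inE y'zs orbT.
    have [b' b'y nb'] := H y (mem_head _ _).
    exists (b * b') => [/(amax_prime _ _ _ zmax)[]//|y'].
    rewrite inE => /orP[/eqP ->|/bzs by']; first by rewrite -mulrA; exact: idealMl.
    by rewrite mulrAC; exact: idealMr.
  apply: nb; have : colon J b setT z.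
    apply: (gens_sub (ideal_colon b iJ (@ideal_setT A))) Gz => [_ ->|y yzs].
      by split=> //; rewrite mulr0; exact: ideal0.
    by split=> //; exact: bzs.
  by case.
exists z' => //; have [_ maxz'] := zsmax z' z'zs.
suff : ann z' x by [].
rewrite -(maxz' z) //; first exact: az.
by case: zmax.
Qed.

End Noetherian.

(** * A regular sequence generating a parameter ideal *)

Section Local.
Variables (A : comNzRingType) (m : set A).
Hypothesis local_m : noetherian_local m.
Implicit Types (I J K L M N P Q Z : set A) (a b s t w x y z : A) (u v : seq A).

Let noeA : noetherian A. Proof. by case: local_m. Qed.
Let maxm : maximal_ideal m. Proof. by case: local_m. Qed.
Let im : ideal m. Proof. by case: maxm. Qed.

Lemma invertible_local x : ~ m x -> invertible x.
Proof.
move=> nmx; have i0 := @ideal_set0 A.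
have [[a _ /= xa]|nx] := pselect (adj [set 0] x 1).
  by exists a; apply/esym/eqP; rewrite -subr_eq0 xa.
pose F := [set J | [/\ ideal J, J x & ~ J 1]].
have [||M [iM Mx nM] maxM] := @noetherian_max A F (adj [set 0] x) noeA.
- by move=> J [].
- by split=> //; [exact: ideal_adj | exact: mem_adj1].
have [_ _ uniq] := local_m.
by case: nmx; rewrite -(uniq M) //; split=> // J iJ MJ nJ; apply: maxM => //; split=> //; exact: MJ.
Qed.

(** Generators of [Z] are discarded from the end: modulo [J] and the others, the last one [g] equals
    [y * a * g] for some [a], and [1 - y * a] is invertible. *)
Lemma nakayama J Z y : ideal J -> ideal Z -> m y ->
  (forall z, Z z -> exists2 z', Z z' & J (z - y * z')) -> Z `<=` J.
Proof.
move=> iJ iZ my ZyZ; have [zs Zzs] := noeA iZ.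
have zsZ x : x \in zs -> Z x.
  by move=> xzs; rewrite Zzs ideal_genE; apply: mem_gens => //; exact: ideal_set0.
have : Z `<=` gens J zs.
  rewrite {1}Zzs ideal_genE; apply: gens_sub => [|_ ->|x]; first exact: ideal_gens.
    by apply: ideal0; exact: ideal_gens.
  exact: mem_gens.
elim/last_ind: zs zsZ {Zzs} => // zs g IHzs zsZ Zsub.
have iG : ideal (gens J zs) by exact: ideal_gens.
apply: IHzs => [x xzs|]; first by apply: zsZ; rewrite mem_rcons inE xzs orbT.
suff Gg : gens J zs g.
  by apply: subset_trans Zsub _; rewrite gens_rcons; apply: adj_sub.
have Zg : Z g by apply: zsZ; rewrite mem_rcons mem_head.
have [g' Zg' Jg] := ZyZ g Zg.
have := Zsub g' Zg'; rewrite gens_rcons => -[a _ Gga].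
have unit1 : invertible (1 - y * a).
  apply: invertible_local => m1; case: maxm => _ + _; apply.
  by rewrite -(subrK (y * a) 1); apply: idealD => //; exact: idealMr.
apply: (invertible_cancel iG unit1).
have -> : (1 - y * a) * g = (g - y * g') + y * (g' - g * a) by ring.
by apply: idealD => //; [exact: sub_gens | exact: idealMl].
Qed.

Lemma adjC J x y : ideal J -> adj (adj J x) y = adj (adj J y) x.
Proof.
move=> iJ; have ia t : ideal (adj J t) by exact: ideal_adj.
have ib t t' : ideal (adj (adj J t) t') by exact: ideal_adj.
have sub t t' : adj (adj J t) t' `<=` adj (adj J t') t.
  apply: adj_sub => //; last by apply: sub_adj; exact: mem_adj1.
  apply: adj_sub => //; last exact: mem_adj1.
  by apply: subset_trans (@sub_adj _ _ _); exact: sub_adj.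
by apply/seteqP; split.
Qed.

(** If [y] kills [a] modulo [J], then [a] is [x * a'] modulo [J] by regularity modulo [adj J x], and
    cancelling [x] shows that [y] kills [a'] as well. Nakayama then puts the colon ideal of [y]
    inside [J]. *)
Lemma reg_swap J x y : ideal J -> m x -> reg J x -> reg (adj J x) y ->
  reg J y /\ reg (adj J y) x.
Proof.
move=> iJ mx regx regy; split=> [z Jyz|z [t _ Jxz]].
  apply: (@nakayama J (colon J y setT) x) => //; first exact: ideal_colon.
  move=> a [_ Jya]; have [a' _ Jaa'] := regy a (sub_adj x Jya).
  exists a' => //; split=> //; apply: regx.
  have -> : x * (y * a') = y * a - y * (a - x * a') by ring.
  by apply: idealB => //; exact: idealMl.
have [t' _ Jtt'] : adj J x t.
  apply: regy; exists z => //.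
  have -> : y * t - x * z = - (x * z - y * t) by ring.
  exact: idealN.
exists t' => //; apply: regx.
have -> : x * (z - y * t') = (x * z - y * t) + y * (t - x * t') by ring.
by apply: idealD => //; exact: idealMl.
Qed.

Lemma regseq_rcons_cons J u x : ideal J -> (forall y, y \in u -> m y) ->
  regseq J (rcons u x) -> regseq J (x :: u).
Proof.
elim: u J => //= y u IHu J iJ um [regy reguy].
have my : m y by apply: um; rewrite mem_head.
have {}um z : z \in u -> m z by move=> zu; apply: um; rewrite inE zu orbT.
have [regx regu] := IHu (adj J y) (ideal_adj y iJ) um reguy.
have [? ?] := reg_swap iJ my regy regx.
by split=> //; split=> //; rewrite adjC.
Qed.

Hypothesis infinite_residue : infinite_set (residue_field m).

Lemma residue_representatives :
  exists c : nat -> A, forall i j, i != j -> invertible (c i - c j).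
Proof.
move/infiniteP/pcard_leP: infinite_residue => [f].
have /choice[c cf] i : exists x, f i = [set y | m (y - x)].
  by have [x _ <-] : residue_field m (f i) by [exact: funS]; exists x.
exists c => i j ij; apply: invertible_local => mij; case/eqP: ij.
have : f i = f j; last by move=> fij; apply: (@inj _ _ _ f) fij; rewrite in_setT.
rewrite !cf; apply/seteqP; split=> x /= mx.
  have -> : x - c j = (x - c i) + (c i - c j) by ring.
  exact: idealD.
have -> : x - c i = (x - c j) - (c i - c j) by ring.
exact: idealB.
Qed.

(** Powers of a single parameter serve as coefficients, so that [size u] distinct residues yield an
    invertible Vandermonde matrix. *)
Definition lin_comb c u := \sum_(i < size u) c ^+ i * u`_i.

(* If all combinations for infinitely many residues [c] were zero divisors, [size u] of them
   would kill one [z], hence by Vandermonde so would [u], and then a power of [x]. *)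
Lemma exists_reg_comb J0 J u x : ideal J0 -> ideal J -> J0 `<=` J -> reg J x ->
    (exists n, gens J0 u (x ^+ n)) ->
  exists c, reg J (lin_comb c u).
Proof.
move=> iJ0 iJ J0J regx [n Qx].
have [c cU] := residue_representatives.
have [zs nzs zs_reg] := zero_divisors_finite noeA iJ.
apply: contrapT => nreg.
have /choice[h Hh] i : exists z, z \in zs /\ J (lin_comb (c i) u * z).
  have [r|z zzs Jz] := zs_reg (lin_comb (c i) u); last by exists z.
  by apply: nreg; exists (c i).
have [z [zzs [ns [uns sns] hns]]] := pigeonhole (size u) (fun n => (Hh n).1).
have Kreg k : J (x ^+ k * z) -> J z.
  by elim: k => [|k IHk]; rewrite ?expr0 ?mul1r // exprS -mulrA => /regx.
apply: (nzs z zzs); apply: (Kreg n).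
have iK : ideal (colon J z setT) by exact: ideal_colon.
rewrite mulrC; suff : colon J z setT (x ^+ n) by case.
apply: (gens_sub iK) Qx => [y /J0J Jy|y].
  by split=> //; exact: idealMl.
move=> /(nthP 0)[k ku <-].
apply: (@vandermonde_mem _ _ _ (fun i : 'I_(size u) => c (nth 0%N ns i))
  (fun i => u`_i) iK _ _ (Ordinal ku)) => [i j ij|i].
  by apply: cU; rewrite nth_uniq ?sns.
split=> //; rewrite -/(lin_comb _ _) mulrC.
by rewrite -(hns (nth 0%N ns i)) ?mem_nth ?sns //; exact: (Hh _).2.
Qed.

(* Exchange: the last term of [v] is replaced by a generic combination of [u], which the
   permutability of regular sequences in [m] then lets us move to the front. *)
Lemma exists_regseq J u v : ideal J -> size v = size u -> regseq J v ->
    (forall x, x \in v -> m x) ->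
    (forall x, m x -> exists n, gens J u (x ^+ n)) ->
  exists w : seq A, [/\ size w = size u, gens J w = gens J u & regseq J w].
Proof.
elim: u J v => [|s u IHu] J v iJ; first by exists [::].
case/lastP: v => // v y; rewrite size_rcons => -[sv] /regseq_rcons[regv regy] vm powm.
have my : m y by apply: vm; rewrite mem_rcons mem_head.
have {}vm x : x \in v -> m x by move=> xv; apply: vm; rewrite mem_rcons inE xv orbT.
have [c regc] : exists c, reg (gens J v) (lin_comb c (s :: u)).
  apply: (@exists_reg_comb J _ _ y) => //; [exact: ideal_gens | exact: sub_gens | exact: powm].
set t := lin_comb _ _ in regc.
have [regt regv'] : regseq J (t :: v) by apply: regseq_rcons_cons => //; apply/regseq_rcons.
have iJt : ideal (adj J t) by exact: ideal_adj.
have iJs : ideal (adj J s) by exact: ideal_adj.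
(* The head [s] has coefficient [c ^+ 0 = 1], so [t] can replace it as a generator. *)
have tE : t = s + \sum_(i < size u) c ^+ i.+1 * u`_i.
  by rewrite /t /lin_comb /= big_ord_recl expr0 mul1r.
have gensE : gens (adj J t) u = gens J (s :: u).
  have tail K : ideal K -> (forall x, x \in u -> K x) -> K (\sum_(i < size u) c ^+ i.+1 * u`_i).
    by move=> iK uK; apply: ideal_sum => // i _; apply: idealMl => //; apply: uK; exact: mem_nth.
  rewrite -[gens J (s :: u)]/(gens (adj J s) u).
  apply/seteqP; split; (apply: gens_sub; [exact: ideal_gens | | by move=> x xu; exact: mem_gens]).
    apply: adj_sub; [exact: ideal_gens | |].
      by apply: subset_trans (@sub_gens _ _ _); exact: sub_adj.
    rewrite tE; apply: idealD; first exact: ideal_gens.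
      by apply: sub_gens; exact: mem_adj1.
    by apply: tail => [|x xu]; [exact: ideal_gens | exact: mem_gens].
  apply: adj_sub; [exact: ideal_gens | |].
    by apply: subset_trans (@sub_gens _ _ _); exact: sub_adj.
  have -> : s = t - \sum_(i < size u) c ^+ i.+1 * u`_i by rewrite tE addrK.
  apply: idealB; first exact: ideal_gens.
    by apply: sub_gens; exact: mem_adj1.
  by apply: tail => [|x xu]; [exact: ideal_gens | exact: mem_gens].
rewrite -gensE in powm *.
have [w [sw wE regw]] := IHu (adj J t) v iJt sv regv' vm powm.
exists (t :: w); split; [by rewrite /= sw | by rewrite -wE | by split].
Qed.

Lemma regular_sequence_regseq u : regular_sequence u -> regseq [set 0] u.
Proof.
case=> regs _; elim/last_ind: u regs => // u x IHu regs; apply/regseq_rcons; split.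
  apply: IHu => i si a; have := regs i _ a; rewrite size_rcons -cats1.
  by rewrite nth_cat si takel_cat ?(ltnW si) //; apply; exact: ltnW.
move=> a; have := regs (size u) _ a; rewrite size_rcons ltnSn nth_rcons ltnn eqxx.
by rewrite -cats1 take_size_cat // !ideal_genE; apply.
Qed.

End Local.

(** * Growth of monomial counts and comparison of Hilbert coefficients *)

Lemma nmon_homo d n k : (n <= k)%N -> (nmon d.+1 n <= nmon d.+1 k)%N.
Proof.
elim: k => [|k IHk]; first by rewrite leqn0 => /eqP ->.
rewrite leq_eqVlt => /orP[/eqP -> //|/IHk nk].
by rewrite nmonSS (leq_trans nk) // leq_addl.
Qed.

Lemma nmon_homo_dim d n : (nmon d n <= nmon d.+1 n)%N.
Proof. by case: n => [|n]; rewrite ?nmon0 // nmonSS leq_addr. Qed.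

Lemma nmon_homo_dims d d' n : (d <= d')%N -> (nmon d n <= nmon d' n)%N.
Proof.
elim: d' => [|d' IHd]; first by rewrite leqn0 => /eqP ->.
rewrite leq_eqVlt => /orP[/eqP -> //|/IHd dd].
exact: leq_trans dd (nmon_homo_dim _ _).
Qed.

(** Pascal's rule telescoped [b] times, each difference being a count in one variable fewer. This
    turns a deficiency into growth of lower order. *)
Lemma nmon_sub d b n : (b <= n)%N ->
  (nmon d.+2 n <= nmon d.+2 (n - b) + b * nmon d.+1 n)%N.
Proof.
elim: b => [|b IHb] bn; first by rewrite subn0 addn0.
apply: leq_trans (IHb (ltnW bn)) _.
have -> : (n - b = (n - b.+1).+1)%N by lia.
have le_n : (nmon d.+1 (n - b.+1).+1 <= nmon d.+1 n)%N by apply: nmon_homo; lia.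
by rewrite nmonSS mulSn; lia.
Qed.

Lemma nmon_dominated d c : exists N, forall n, (N <= n)%N -> (c * nmon d n < nmon d.+1 n)%N.
Proof.
case: d => [|d].
  by exists 1%N => -[//|n] _; rewrite muln0 /= bin0.
(* The ratio of the two counts is [(n + d.+1) / d.+1], which exceeds [c] from this bound on. *)
exists (d.+1 * c)%N => n cn; rewrite ltnNge; apply/negP => le_c.
have := mul_bin_diag (n + d.+1) d; rewrite addnS /= => E.
have : (0 < nmon d.+1 n)%N by rewrite /= bin_gt0 leq_addl.
move: le_c E => /=; rewrite addnS; nia.
Qed.

Lemma nmon_coef0 d (a c : int) (N : nat) :
  (forall n, (N < n)%N -> `|a| * (nmon d.+1 n)%:Z <= c * (nmon d n)%:Z) -> a = 0.
Proof.
move=> le_c; apply/eqP; rewrite -normr_le0 leNgt; apply/negP => a0.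
have [N' dom] := nmon_dominated d `|c|.
have := le_c (maxn N N').+1 (leq_maxl _ _); have := dom (maxn N N').+1 (leqW (leq_maxr _ _)).
move: (nmon _ _) (nmon _ _) => x y xy.
nia.
Qed.

(** Adjoining the elements of [v] to [K] one by one gives cyclic layers. Each full layer adds 1 to
    [r]; a deficient one with gap [b] adds [b] to [c] and forces [N] to be at least [b]. *)
Lemma sally_growth (A : comNzRingType) (m K : set A) (u v : seq A) d :
    maximal_ideal m -> gens [set 0] u `<=` m -> ideal K -> size u = d.+2 ->
    (forall w x, w \in v -> m x -> K (w * x)) ->
  exists H r c N, forall n, (N <= n)%N ->
    [/\ len_eq (ideal_mul (ideal_exp (gens [set 0] u) n) K)
               (ideal_mul (ideal_exp (gens [set 0] u) n) (gens K v)) (H n),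
        (r * nmon d.+2 n <= H n)%N & (H n <= r * nmon d.+2 n + c * nmon d.+1 n)%N].
Proof.
move=> mm um + su; have iQ : ideal (gens [set 0] u) by exact/ideal_gens/ideal_set0.
have iQn k : ideal (ideal_exp (gens [set 0] u) k) by exact: ideal_ideal_exp.
elim: v K => [|w v IHv] K iK mK.
  exists (fun=> 0%N), 0%N, 0%N, 0%N => n _; split=> //.
  exact/len_eqxx/ideal_ideal_mul.
have iKw : ideal (adj K w) by exact: ideal_adj.
have mKw w' x : w' \in v -> m x -> adj K w (w' * x).
  by move=> w'v mx; apply: sub_adj; apply: mK => //; rewrite inE w'v orbT.
have [H [r [c [N HN]]]] := IHv (adj K w) iKw mKw.
have [|||f Hf f_or] := @cyclic_dichotomy A m u
    (fun n => ideal_mul (ideal_exp (gens [set 0] u) n) K) w mm um.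
- by move=> n; exact: ideal_ideal_mul.
- move=> n x y Qx Ky; rewrite /= -ideal_mulA //; exact: mem_ideal_mul.
- by move=> x mx; rewrite /= ideal_mul1 //; apply: mK => //; exact: mem_head.
have lenD n : (N <= n)%N -> len_eq (ideal_mul (ideal_exp (gens [set 0] u) n) K)
    (ideal_mul (ideal_exp (gens [set 0] u) n) (gens K (w :: v))) (f n + H n)%N.
  move=> Nn; have [HH _ _] := HN n Nn; apply: len_eqD HH.
  - exact: ideal_ideal_mul.
  - exact: ideal_ideal_mul.
  - by apply: ideal_mulS => //; exact: sub_adj.
  - by apply: ideal_mulS => //; exact: sub_gens.
  - by rewrite ideal_mul_mix // (ideal_mulC _ setT) ideal_mul1.
rewrite su in f_or; case: f_or => [full|[b def]].
  exists (fun n => f n + H n)%N, r.+1, c, N => n Nn; split; first exact: lenD.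
    by have [_ lo _] := HN n Nn; rewrite full mulSn leq_add2l.
  by have [_ _ hi] := HN n Nn; rewrite full mulSn -addnA leq_add2l.
exists (fun n => f n + H n)%N, r, (b + c)%N, (maxn N b) => n; rewrite geq_max => /andP[Nn bn].
have [_ lo hi] := HN n Nn; split; [exact: lenD | by rewrite (leq_trans lo) ?leq_addl|].
have := def n; rewrite bn => defn; have := nmon_sub d bn; move: defn hi.
move: (nmon d.+2 n) (nmon d.+2 (n - b)) (nmon d.+1 n) => x y z; nia.
Qed.

Lemma hilbert_coef_le (k : nat) (e : nat -> int) (q l r c N : nat) (H : nat -> nat) :
    (forall n, (N <= n)%N ->
       [/\ (r * nmon k.+2 n <= H n)%N, (H n <= r * nmon k.+2 n + c * nmon k.+1 n)%N &
        (q * nmon k.+3 n + l * nmon k.+2 n.+1)%N%:Z = (H n)%:Z +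
          \sum_(i < k.+3) (-1) ^+ i * e i * (nmon (k.+2 - i).+1 n.+1)%:Z]) ->
  e 0%N - l%:Z + e 2%N <= e 1%N.
Proof.
move=> HN.
pose R n : int := \sum_(i < k) (-1) ^+ i.+3 * e i.+3 * (nmon (k - i) n)%:Z.
pose E : int := \sum_(i < k) `|e i.+3|.
have leR n : `|R n| <= E * (nmon k n)%:Z.
  apply: le_trans (ler_norm_sum _ _ _) _; rewrite mulr_suml; apply: ler_sum => i _.
  rewrite normrM normrMsign; apply: ler_wpM2l => //.
  by rewrite ger0_norm // lez_nat; apply: nmon_homo_dims; exact: leq_subr.
have E0 : 0 <= E by exact: sumr_ge0.
(* Pascal's rule brings all terms to the same degree: raising the degree of the count with factor
   [q] puts [- q] into [b], and doing so for [r] puts [r] into the third coefficient. The terms from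
   [e 3] on are collected in [R], of order [nmon k]. *)
pose b : int := l%:Z - q%:Z + e 1%N - r%:Z.
have main n : (N < n)%N -> exists2 h : int, 0 <= h <= c%:Z * (nmon k.+1 n)%:Z &
    (q%:Z - e 0%N) * (nmon k.+3 n)%:Z + b * (nmon k.+2 n)%:Z
      + (r%:Z - e 2%N) * (nmon k.+1 n)%:Z = h + R n.
  case: n => // n Nn; have [lo hi] := HN n Nn.
  have -> : \sum_(i < k.+3) (-1) ^+ i * e i * (nmon (k.+2 - i).+1 n.+1)%:Z =
      e 0%N * (nmon k.+3 n.+1)%:Z - e 1%N * (nmon k.+2 n.+1)%:Z
      + e 2%N * (nmon k.+1 n.+1)%:Z + R n.+1.
    rewrite !big_ord_recl !addrA; congr (_ + _ + _ + _).
    - by rewrite expr0 mul1r.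
    - by rewrite expr1 mulN1r mulNr subSS subn0.
    - by rewrite /= /bump /= sqrrN expr1n mul1r !subSS subn0.
    - by apply: eq_bigr => i _; rewrite -(subnSK (ltn_ord i)) /= /bump /= !add1n !subSS.
  move=> Heq.
  exists ((H n)%:Z - (r * nmon k.+2 n)%N%:Z).
    rewrite subr_ge0 lez_nat lo lerBlDl -PoszM -PoszD lez_nat (leq_trans hi) // leq_add2l leq_mul2l.
    by rewrite nmon_homo // orbT.
  move: Heq; rewrite /b !nmonSS !PoszD !PoszM !PoszD; lia.
have X01 n : (nmon k n)%:Z <= (nmon k.+1 n)%:Z by rewrite lez_nat nmon_homo_dim.
have X12 n : (nmon k.+1 n)%:Z <= (nmon k.+2 n)%:Z by rewrite lez_nat nmon_homo_dim.
have bound n h : 0 <= h <= c%:Z * (nmon k.+1 n)%:Z ->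
    `|h + R n| <= (c%:Z + E) * (nmon k.+1 n)%:Z.
  move=> /andP[h0 hc]; apply: le_trans (ler_normD _ _) _; rewrite mulrDl lerD //.
    by rewrite ger0_norm.
  by apply: le_trans (leR n) _; exact: ler_wpM2l.
have a0 : q%:Z - e 0%N = 0.
  apply: (@nmon_coef0 k.+2 _ (c%:Z + E + `|b| + `|r%:Z - e 2%N|) N) => n Nn.
  have [h /bound hR Eq] := main n Nn.
  rewrite -[(nmon k.+3 n)%:Z]ger0_norm // -normrM.
  have -> : (q%:Z - e 0%N) * (nmon k.+3 n)%:Z =
    h + R n - b * (nmon k.+2 n)%:Z - (r%:Z - e 2%N) * (nmon k.+1 n)%:Z by rewrite -Eq; ring.
  rewrite [leRHS]mulrDl [X in _ <= X + _]mulrDl; apply: le_trans (ler_normB _ _) _; apply: lerD.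
    apply: le_trans (ler_normB _ _) _; apply: lerD.
      by apply: le_trans hR _; apply: ler_wpM2l => //; exact: addr_ge0.
      by rewrite normrM [`|(nmon _ _)%:Z|]ger0_norm.
  by rewrite normrM [`|(nmon _ _)%:Z|]ger0_norm //; exact: ler_wpM2l.
have b0 : b = 0.
  apply: (@nmon_coef0 k.+1 _ (c%:Z + E + `|r%:Z - e 2%N|) N) => n Nn.
  have [h /bound hR Eq] := main n Nn.
  rewrite -[(nmon k.+2 n)%:Z]ger0_norm // -normrM.
  have -> : b * (nmon k.+2 n)%:Z =
    h + R n - (r%:Z - e 2%N) * (nmon k.+1 n)%:Z by rewrite -Eq a0; ring.
  rewrite [leRHS]mulrDl; apply: le_trans (ler_normB _ _) _; apply: lerD => //.
  by rewrite normrM [`|(nmon _ _)%:Z|]ger0_norm.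
(* Once the two leading coefficients vanish, [(r - e 2) * nmon k.+1 n = h + R n] with [h]
   nonnegative. A negative integer [r - e 2] would make the left side at most [- nmon k.+1 n], below
   what [R n] allows at this [n]. *)
have [N' dom] := nmon_dominated k `|E|.
pose n := (maxn N N').+1.
have [h /andP[h0 _]] := main n (leq_maxl _ _).
rewrite a0 b0 !mul0r !add0r => Eq.
have g0 : 0 <= r%:Z - e 2%N.
  rewrite leNgt; apply/negP => g0.
  have := dom n (leqW (leq_maxr _ _)); have := leR n; move: Eq.
  move: (nmon _ _) (nmon _ _) (R n) => x1 x0 t; nia.
by move: a0 b0 g0; rewrite /b; lia.
Qed.

Lemma len_eq_exp (A : comNzRingType) (u : seq A) q n :
    regseq [set 0] u -> len_eq (gens [set 0] u) setT q ->
  len_eq (ideal_exp (gens [set 0] u) n.+1) setT (q * nmon (size u).+1 n)%N.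
Proof.
move=> regu lenQ; have iQ : ideal (gens [set 0] u) by exact/ideal_gens/ideal_set0.
elim: n => [|n IHn]; first by rewrite nmon0 muln1 ideal_exp1.
rewrite nmonSS mulnDr; apply: len_eqD IHn => //; first exact: ideal_ideal_exp.
  exact: ideal_expS_sub.
rewrite [X in len_eq X]/= ideal_mulC; exact: len_eq_gens_exp.
Qed.

Theorem theorem3p3 (A : comNzRingType) (m : set A) (d : nat) (I Q : set A)
    (e : nat -> int) (l : nat)
    (hCM : cohen_macaulay_local m)
    (hdim : krull_dim A d)
    (hd : (2 <= d)%N)
    (hres : infinite_set (residue_field m))
    (hI : primary_to m I)
    (hQ : parameter_ideal m d Q)
    (hred : reduction Q I)
    (hI3 : ideal_exp I 3 = ideal_mul Q (ideal_exp I 2))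
    (hmI2 : ideal_mul m (ideal_exp I 2) `<=` ideal_mul Q I)
    (he : hilbert_coefficients d I e)
    (hl : has_colength I l) :
  e 0%N - l%:Z + e 2%N <= e 1%N.
Proof.
have [local_m [d' [hd' [[y [regy my sy]] _]]]] := hCM.
have {hd' sy}sy : size y = d by rewrite sy; apply: max_chain_length_uniq hd' hdim.
have [noeA mm _] := local_m.
have [[iI _ _] _] := hI; have [[[iQ _ _] radQ] [s [ss Qs]]] := hQ.
have QI : Q `<=` I by case: hred.
have Qm : Q `<=` m by move=> x Qx; rewrite -radQ; exists 1%N; rewrite expr1.
have i0 := @ideal_set0 A.
have [u [su uQ regu]] : exists u : seq A,
    [/\ size u = size s, gens [set 0] u = gens [set 0] s & regseq [set 0] u].
  apply: (exists_regseq local_m hres i0 _ (regular_sequence_regseq regy)) => //.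
    by rewrite sy ss.
  by move=> x; rewrite -radQ => -[n Qx]; exists n; rewrite -ideal_genE -Qs.
rewrite -[gens _ s]ideal_genE -Qs in uQ; rewrite ss in su.
have iIn n : ideal (ideal_exp I n) by exact: ideal_ideal_exp.
have iQn n : ideal (ideal_exp Q n) by exact: ideal_ideal_exp.
have iQI : ideal (ideal_mul Q I) by exact: ideal_ideal_mul.
have expI n : ideal_mul (ideal_exp Q n) (ideal_exp I 2) = ideal_exp I n.+2.
  elim: n => [|n IHn]; first by rewrite ideal_mul1.
  rewrite -(addn3 n) ideal_expD // hI3 ideal_mulA // (ideal_mulC _ Q) -ideal_mulA //.
  by rewrite -ideal_expD // addn2 -IHn ideal_mulA.
have QnI n : ideal_mul (ideal_exp Q n) (ideal_mul Q I) = ideal_mul (ideal_exp Q n.+1) I.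
  by rewrite ideal_mulA // [ideal_mul _ Q]ideal_mulC.
have [N lenI] := he.
have [q lenQ] : fin_len Q setT.
  (* The exponent [N.+3] is large enough both for the length to be finite and for
     [I^N.+3 = Q^N.+1 I^2] to carry a positive power of [Q], hence to lie in [Q]. *)
  have [p [lenp _]] := lenI N.+2 (leqW (leqnSn _)).
  have [] // := @len_sub _ (ideal_exp I N.+3) setT Q setT; last by exists p.
  rewrite -expI; apply: ideal_mul_sub => // a b [j [x [z [Qx _ ->]]]] _.
  by apply: idealMr => //; apply: ideal_sum => // i _; exact: idealMr.
have [v vI2] := noeA _ (iIn 2); rewrite ideal_genE in vI2.
have mvQI w x : w \in v -> m x -> ideal_mul Q I (w * x).
  move=> wv mx; apply: hmI2; rewrite mulrC; apply: mem_ideal_mul => //.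
  by rewrite vI2; exact: mem_gens.
have QIv : gens (ideal_mul Q I) v = ideal_exp I 2.
  apply/seteqP; split; last first.
    rewrite vI2; apply: gens_sub => [|_ ->|x xv].
    - exact: ideal_gens.
    - by apply: ideal0; exact: ideal_gens.
    - exact: mem_gens.
  apply: gens_sub => // [|x xv]; last by rewrite vI2; exact: mem_gens.
  by rewrite /= [ideal_mul I setT]ideal_mulC ideal_mul1 //; exact: ideal_mulS.
case: d hd => [|[|k]] // _ in hdim he lenI su sy ss hQ *.
have um : gens [set 0] u `<=` m by rewrite uQ.
have [H [r [c [N' HN]]]] := sally_growth mm um iQI su mvQI.
apply: (@hilbert_coef_le k e q l r c (maxn N N') H) => n; rewrite geq_max => /andP[Nn N'n].
have := HN n N'n; rewrite uQ QIv QnI expI => -[lenH lo hi]; split=> //.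
have [p [lenp pE]] := lenI n.+1 (leqW Nn).
have {pE} -> : \sum_(i < k.+3) (-1) ^+ i * e i * (nmon (k.+2 - i).+1 n.+1)%:Z = p%:Z.
  by rewrite pE; apply: eq_bigr => i _; rewrite /= addnBA // -ltnS.
rewrite -PoszD; congr Posz.
have lenQn : len_eq (ideal_exp Q n.+1) setT (q * nmon k.+3 n)%N.
  by rewrite -uQ -su; apply: len_eq_exp => //; rewrite uQ.
have lenQI : len_eq (ideal_mul (ideal_exp Q n.+1) I) (ideal_exp Q n.+1) (l * nmon k.+2 n.+1)%N.
  by rewrite -uQ -su; apply: len_eq_gens_exp; rewrite // uQ.
(* The length of [A / Q^n.+1 I] is computed twice: through [Q^n.+1], and through [I^n.+2], where
   [H n] appears. *)
apply: (@max_chain_length_uniq _ (between (ideal_mul (ideal_exp Q n.+1) I) setT)).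
  rewrite addnC; apply: len_eqD lenQI lenQn => //.
  by rewrite ideal_mulC; exact: ideal_mul_subr.
apply: len_eqD lenH lenp => //.
by rewrite -QnI -expI; apply: ideal_mulS => //; rewrite -QIv; exact: sub_gens.
Qed.
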